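(* Assume that $\operatorname{cov}(\mathcal{M})=\operatorname{cof}(\mathcal{M})$ and that the cardinal number $\operatorname{cov}(\mathcal{M})$ is regular. Then there are $\operatorname{cov}(\mathcal{M})$-Luzin sets $X$ and $Y$ such that the spaces $\mathrm{C}_{\mathrm{p}}(X)$ and $\mathrm{C}_{\mathrm{p}}(Y)$ have countable strong fan tightness (and are R-separable), but the product space $\mathrm{C}_{\mathrm{p}}(X)\times\mathrm{C}_{\mathrm{p}}(Y)$ does not have countable fan tightness (and is not M-separable).
   Context: $\operatorname{cov}(\mathcal{M})$ is the minimal cardinality of a family of meager subsets of $\mathbb{R}$ that covers $\mathbb{R}$; $\operatorname{cof}(\mathcal{M})$ is the minimal cardinality of a family of meager subsets of $\mathbb{R}$ such that every meager subset of $\mathbb{R}$ is contained in a member of the family (replacing $\mathbb{R}$ by $P(\mathbb{N})\cong\{0,1\}^{\mathbb{N}}$ gives the same cardinals). A set of reals is a space homeomorphic to a subset of the real line. A set of reals $X$, viewed as a subset of $\mathbb{R}$ (or of $P(\mathbb{N})$), is a $\operatorname{cov}(\mathcal{M})$-Luzin set if $|X|\ge\operatorname{cov}(\mathcal{M})$ and $|X\cap M|<\operatorname{cov}(\mathcal{M})$ for every meager subset $M$ of the ambient space. $\mathrm{C}_{\mathrm{p}}(X)$ is the space of all continuous real-valued functions on $X$ with the topology of pointwise convergence. A space $Z$ has countable fan tightness if for each point $z\in Z$ and every sequence $U_1,U_2,\dots$ of subsets of $Z$ with $z\in\bigcap_n\overline{U_n}$ there are finite sets $F_1\subseteq U_1,F_2\subseteq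 U_2,\dots$ with $z\in\overline{\bigcup_n F_n}$; if the sets $F_n$ can always be chosen to be singletons, $Z$ has countable strong fan tightness. A space is M-separable if for every sequence $D_1,D_2,\dots$ of dense subsets of the space there are finite sets $F_1\subseteq D_1,F_2\subseteq D_2,\dots$ such that $\bigcup_nF_n$ is dense in the space; if the sets $F_n$ can always be chosen to be singletons, the space is R-separable. *)

(* Defs.v *)
From HB Require Import structures.
From mathcomp Require Import all_boot all_order all_algebra.
From mathcomp Require wochoice.
From mathcomp Require Import all_classical all_reals all_analysis.

Set Implicit Arguments.
Unset Strict Implicit.
Unset Printing Implicit Defensive.

Import Order.TTheory GRing.Theory Num.Theory.
Import numFieldNormedType.Exports.

Local Open Scope classical_set_scope.
Local Open Scope card_scope.

Definition card_lt T U (A : set T) (B : set U) : bool :=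
  (A #<= B) && ~~ (B #<= A).

Definition least_card U (P : set (set U)) : set (set U) :=
  [set F | P F /\ forall G, P G -> F #<= G].

(* The elements of P are compared through a set S of choice functions any two
   of which differ at every index; for S maximal, some projection is onto. *)
Lemma least_card_ex U (P : set (set U)) : P !=set0 -> least_card P !=set0.
Proof.
move=> [G0 PG0].
pose Q := [set S : set (P -> U) |
  (forall s, S s -> forall i, (val i) (s i)) /\
  (forall s t, S s -> S t -> forall i, s i = t i -> s = t)].
have [|S [[Sin Sinj] Smax]] := @Zorn_bigcup _ Q.
  move=> F FQ totF; split=> [s [S FS Ss] i|s t [S FS Ss] [S' FS' St] i sti].
    exact: (FQ _ FS).1.
  have [SS'|S'S] := totF _ _ FS FS'.
    by apply: (FQ _ FS').2 sti => //; exact: SS'.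
  by apply: (FQ _ FS).2 sti => //; exact: S'S.
have [i Si] : exists i : P, forall u, (val i) u -> exists2 s, S s & s i = u.
  apply: contrapT => noi.
  have {}noi (i : P) : exists u, (val i) u /\ forall s, S s -> s i <> u.
    apply: contrapT => nou; apply: noi; exists i => u iu.
    apply: contrapT => ns; apply: nou; exists u; split=> // s Ss siu.
    by apply: ns; exists s.
  have [t tP] := choice noi.
  have nSt : ~ S t by move=> /(fun St => (tP (exist _ G0 (mem_set PG0))).2 t St).
  apply: (Smax (S `|` [set t])).
    by split=> [|sub]; [exact: subsetUl|apply/nSt/sub; right].
  split=> [s [/Sin//|->] j|s s' [Ss|->] [Ss'|->] j // ssj].
  - exact: (tP j).1.
  - exact: Sinj ssj.
  - by have := (tP j).2 s Ss.
  - by have := (tP j).2 s' Ss' (esym ssj).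
exists (val i); split; first exact/set_mem/(valP i).
move=> G PG; pose j : P := exist _ G (mem_set PG).
have iS : val i #<= S.
  apply: card_le_trans (card_image_le (fun s : P -> U => s i) S).
  by apply: subset_card_le => u /Si[s Ss <-]; exists s.
apply: (card_le_trans iS); change G with (val j).
have jinj : {in S &, injective (fun s : P -> U => s j)}.
  by move=> s t /set_mem Ss /set_mem St; exact: Sinj.
rewrite -(card_le_eql (inj_card_eq jinj)).
by apply: subset_card_le => _ [s Ss <-]; exact: Sin.
Qed.

Section meager.
Context {T : topologicalType}.
Implicit Types A M : set T.

Definition nowhere_dense A := interior (closure A) = set0.

Definition meager M :=
  exists2 A : nat -> set T, forall n, nowhere_dense (A n) & M `<=` \bigcup_n A n.

Definition meager_cover : set (set (set T)) :=
  [set F | F `<=` meager /\ \bigcup_(A in F) A = setT].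

Definition meager_base : set (set (set T)) :=
  [set F | F `<=` meager /\ forall M, meager M -> exists2 A, F A & M `<=` A].

End meager.

(* A cardinal number is represented by a set of that cardinality: covM and cofM
   are families of least cardinality, to be used only up to #=. *)
Definition covM (R : realType) : set (set R) := get (least_card (@meager_cover R)).
Arguments covM : clear implicits.

Definition cofM (R : realType) : set (set R) := get (least_card (@meager_base R)).
Arguments cofM : clear implicits.

Lemma meager1 (R : realType) (x : R) : meager [set x].
Proof.
exists (fun=> [set x]) => [n|y ->]; last by exists 0%N.
have cx : closed [set x].
  by apply/accessible_closed_set1/hausdorff_accessible/Rhausdorff.
rewrite /nowhere_dense -(iffLR (closure_id _) cx) -subset0 => y xy.
have yx := interior_subset xy; rewrite /= in yx; subst y.
have /nbhs_ballP[e /= e0 xe] : nbhs x [set x] by [].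
have /xe/eqP : ball x e (x + e / 2)%R.
  rewrite /ball /= opprD addrA subrr add0r normrN gtr0_norm ?divr_gt0 //.
  by rewrite gtr_pMr // invf_lt1 // ltr1n.
by rewrite -subr_eq0 addrAC subrr add0r gt_eqF // divr_gt0.
Qed.

Lemma covMP (R : realType) : least_card (@meager_cover R) (covM R).
Proof.
apply: getPex; apply: least_card_ex; exists (range (@set1 R)); split=> [_ [x _ <-]|].
  exact: meager1.
by rewrite -subTset => x _; exists [set x] => //; exists x.
Qed.

Lemma cofMP (R : realType) : least_card (@meager_base R) (cofM R).
Proof.
by apply: getPex; apply: least_card_ex; exists meager; split=> // M Mm; exists M.
Qed.

(* r is isomorphic to the initial ordinal of cardinality K *)
Definition initial_order U (K : set U) (r : rel K) :=
  wochoice.well_order r /\ forall x : K, card_lt [set y | r y x /\ y <> x] K.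

Definition cofinal_set U (r : rel U) : set (set U) :=
  [set C | forall x, exists2 y, C y & r x y].

(* K is infinite and equal to its own cofinality *)
Definition regular_card U (K : set U) :=
  infinite_set K /\
  exists2 r : rel K, initial_order r & least_card (cofinal_set r) [set: K].

Definition luzin (T : topologicalType) U (K : set U) (X : set T) :=
  K #<= X /\ forall M : set T, meager M -> card_lt (X `&` M) K.

Section selection.
Variable Z : topologicalType.

Definition countable_fan_tightness :=
  forall (z : Z) (U : nat -> set Z), (forall n, closure (U n) z) ->
  exists2 F : nat -> set Z,
    forall n, finite_set (F n) /\ F n `<=` U n & closure (\bigcup_n F n) z.

Definition countable_strong_fan_tightness :=
  forall (z : Z) (U : nat -> set Z), (forall n, closure (U n) z) ->
  exists2 f : nat -> Z, forall n, U n (f n) & closure (range f) z.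

Definition M_separable :=
  forall D : nat -> set Z, (forall n, dense (D n)) ->
  exists2 F : nat -> set Z,
    forall n, finite_set (F n) /\ F n `<=` D n & dense (\bigcup_n F n).

Definition R_separable :=
  forall D : nat -> set Z, (forall n, dense (D n)) ->
  exists2 f : nat -> Z, forall n, D n (f n) & dense (range f).

End selection.

Definition Cp (R : realType) (X : topologicalType) : topologicalType :=
  set_type [set f : {ptws X -> R} | continuous (f : X -> R)].

(* Main.v *)
Require Import Defs.
From mathcomp Require Import all_boot all_order all_algebra.
From mathcomp Require Import zify ring lra.
From mathcomp Require wochoice.
From mathcomp Require Import all_classical all_reals all_analysis.
Import Order.TTheory GRing.Theory Num.Theory.
Import numFieldNormedType.Exports.

Set Implicit Arguments.
Unset Strict Implicit.
Unset Printing Implicit Defensive.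

Local Open Scope classical_set_scope.
Local Open Scope card_scope.

(* A point of 2^N is Cohen over a family of meager sets if it avoids them all.
   Since cov(M) = cof(M) = K is regular, meager sets have a base indexed by K,
   and a recursion of length K yields z_a and z'_a = z_a + u_a, together with
   reals c_a, such that every finite increasing sequence starting with some c_d
   and continuing with z_a's (or with z'_a's), d <= a, is Cohen over the first d
   members of the base. Hence both sequences are Luzin.

   Each sequence satisfies S_1(Omega, Omega), whence strong fan tightness. Given
   a sequence of omega-covers, the finite subsets of {z_a : a < d} that remain to
   be covered can be absorbed into fewer than K dense G_delta sets; for d closed
   under the resulting bounds, the single real c_d, read as a choice of one member
   in each cover, works for all finite sets: c_d does not depend on the covers,
   only its decoding does.

   On the other hand the u_a are infinite but as sparse as one likes, because the
   base also yields a dominating family of size K. So on the product the n-th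
   element of z_a + z'_b is a continuous function of (z_a, z'_b) and these
   functions are not bounded by any h : N -> N. This refutes fan tightness. *)

(** * Small sets below a regular cardinal *)

Section well_order.
Context {K : eqType} {r : rel K}.
Hypothesis wo : wochoice.well_order r.

Definition wo_lt (x y : K) := r x y && (x != y).

Lemma wo_refl : reflexive r.
Proof.
move=> x; have [|z [[/eqP -> zx] _]] := wo (A := pred1 x).
  by exists x; rewrite inE.
by apply: zx; rewrite inE.
Qed.

Lemma wo_total : total r.
Proof.
move=> x y; have [|z [[zxy zP] _]] := wo (A := pred2 x y).
  by exists x; rewrite inE eqxx.
move: zxy zP; rewrite inE => /orP[]/eqP-> zP.
  by rewrite (zP y) ?inE ?eqxx ?orbT.
by rewrite (zP x) ?inE ?eqxx ?orbT.
Qed.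

Lemma wo_anti : antisymmetric r.
Proof.
move=> x y /andP[xy yx]; have [|z [_ zu]] := wo (A := pred2 x y).
  by exists x; rewrite inE eqxx.
have mx t : t = x \/ t = y -> wochoice.minimum_of r (pred2 x y) t.
  by case=> ->; split; rewrite ?inE ?eqxx ?orbT // => u;
    rewrite inE => /orP[]/eqP-> //; exact: wo_refl.
by rewrite -(zu x (mx x (or_introl erefl))) (zu y (mx y (or_intror erefl))).
Qed.

Lemma wo_trans : transitive r.
Proof.
move=> y x z xy yz; have [|m [[mA mP] _]] := wo (A := pred3 x y z).
  by exists x; rewrite inE eqxx.
have mx := mP x; have my := mP y; have mz := mP z.
move: mA mx my mz; rewrite !inE !eqxx ?orbT => /or3P[]/eqP-> mx my mz.
- exact: mz.
- have -> : x = y by apply: wo_anti; rewrite xy mx.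
  exact: yz.
- have <- : y = z by apply: wo_anti; rewrite yz my.
  exact: xy.
Qed.

Lemma wo_ltNge x y : wo_lt x y = ~~ r y x.
Proof.
rewrite /wo_lt; apply/andP/idP => [[xy]|nyx].
  by apply: contra => yx; apply/eqP/wo_anti; rewrite xy.
have /orP[xy|yx] := wo_total x y; last by rewrite yx in nyx.
by split=> //; apply: contraNN nyx => /eqP ->; exact: wo_refl.
Qed.

Lemma wo_ltW x y : wo_lt x y -> r x y.
Proof. by case/andP. Qed.

Lemma wo_lt_le_trans y x z : wo_lt x y -> r y z -> wo_lt x z.
Proof.
rewrite !wo_ltNge => nyx yz; apply: contra nyx => zx.
exact: wo_trans zx.
Qed.

Lemma wo_lt_trans : transitive wo_lt.
Proof. by move=> y x z xy /wo_ltW; exact: wo_lt_le_trans. Qed.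

Lemma wo_min (A : set K) : A !=set0 -> exists2 m, A m & forall x, A x -> r m x.
Proof.
move=> [a Aa]; have [|m [[mA mP] _]] := wo (A := fun x => `[< A x >]).
  by exists a; apply/asboolP.
exists m; first exact/asboolP.
by move=> x Ax; apply: mP; apply/asboolP.
Qed.

Lemma wo_lt_wf : well_founded wo_lt.
Proof.
move=> x; apply: contrapT => nx.
have [m nm mP] := @wo_min [set y | ~ Acc wo_lt y] (ex_intro _ x nx).
apply: nm; constructor => y ym; apply: contrapT => /mP.
by move: ym; rewrite wo_ltNge => /negP.
Qed.

(** The history of a recursion at stage [a], made total by the default [v0], so that a stage can be
    stated for plain functions on [K]. *)
Definition below V (v0 : V) (f : K -> V) (a b : K) : V := if wo_lt b a then f b else v0.

(** Transfinite recursion with a choice at each stage: [P a] relates the history to the admissible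
    values and need not determine the value. *)
Lemma wo_recursion V (v0 : V) (P : K -> (K -> V) -> V -> Prop) :
  (forall a f, exists v, P a f v) ->
  exists f, forall a, P a (below v0 f a) (f a).
Proof.
move=> Pex.
pose F a (g : forall b, wo_lt b a -> V) := sval (cid (Pex a
  (fun b => if @idP (wo_lt b a) is ReflectT h then g b h else v0))).
pose f := Fix wo_lt_wf (fun=> V) F.
exists f => a; rewrite {2}/f Fix_eq; last first.
  by move=> x g g' gg'; congr F; apply: functional_extensionality_dep => b;
     apply: functional_extensionality_dep => h; exact: gg'.
rewrite -/f /F; case: cid => v /= ; congr (P _ _ _); apply/funext => b.
by rewrite /below; case: {-}_ / idP => [->//|/negP/negbTE ->].
Qed.

End well_order.
Arguments wo_lt {K} r x y.
Arguments below {K} r {V} v0 f a b.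

Lemma card_leTP T U (A : set T) :
  [set: U] #<= A <-> exists2 f : U -> T, (forall u, A (f u)) & injective f.
Proof.
split=> [/card_leP[f]|[f Af fI]].
  exists (fun u => val (f (exist _ u (mem_set I)))) => [u|u v].
    exact/set_mem/valP.
  by move=> /val_inj/(@inj _ _ _ f)-/(_ (mem_set I) (mem_set I))/(congr1 val).
have fS : {in [set: U] &, injective f} by move=> u v _ _; exact: fI.
rewrite -(card_le_eql (inj_card_eq fS)); apply: subset_card_le => _ [u _ <-].
exact: Af.
Qed.

Section small.
Context {K : eqType} {r : rel K}.
Hypothesis wo : wochoice.well_order r.
Hypothesis init : forall x, ~~ ([set: K] #<= [set y | wo_lt r y x]).
Hypothesis reg : forall C, cofinal_set r C -> [set: K] #<= C.
Hypothesis unc : ~~ ([set: K] #<= [set: nat]).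

(* Smaller than [K]; stated negatively because cardinals are not known to be comparable. *)
Definition small U (A : set U) := ~~ ([set: K] #<= A).

Lemma small_le U V (A : set U) (B : set V) : A #<= B -> small B -> small A.
Proof. by move=> AB; apply: contra => /card_le_trans; exact. Qed.

Lemma small_image U V (f : U -> V) (A : set U) : small A -> small (f @` A).
Proof. by apply: small_le; exact: card_image_le. Qed.

Lemma small_sub U (A B : set U) : A `<=` B -> small B -> small A.
Proof. by move=> AB; apply: small_le; exact: subset_card_le. Qed.

Lemma small_countable U (A : set U) : countable A -> small A.
Proof. by move=> cA; apply: small_le unc. Qed.

(** A set without a strict upper bound is cofinal, and by regularity a cofinal set is not small. *)
Lemma small_bounded (A : set K) : small A -> exists x, forall a, A a -> wo_lt r a x.
Proof.
move=> /negP sA; apply: contrapT => nx; apply: sA; apply: reg => x.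
apply: contrapT => nA; apply: nx; exists x => a Aa; rewrite (wo_ltNge wo).
by apply/negP => xa; apply: nA; exists a.
Qed.

(** Suppose [j] embeds [K] in the union. The points sent into one [F i] form a small set, hence lie
    below some [b i], and the [b i] lie below some [x]. But [j x] lies in some [F i], so [x] is
    below that [b i]. *)
Lemma small_bigcup T U (D : set T) (F : T -> set U) :
  small D -> (forall i, D i -> small (F i)) -> small (\bigcup_(i in D) F i).
Proof.
move=> sD sF; apply/negP => /card_leTP[j jF jI].
have bex i : exists x, D i -> forall a, F i (j a) -> wo_lt r a x.
  have [Di|nDi] := pselect (D i); last first.
    by have [k _] := small_bounded (small_countable (countable0 K)); exists k.
  have [|x xP] := @small_bounded (j @^-1` F i); last by exists x.
  apply/negP => /card_leTP[f fF fI]; move/negP: (sF _ Di); apply.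
  by apply/card_leTP; exists (j \o f) => // u v /jI/fI.
have [b bP] := choice bex.
have [x xP] := small_bounded (small_image b sD).
have [i Di Fi] := jF x.
have := xP (b i) (ex_intro2 _ _ _ Di erefl).
have := bP i Di x Fi; rewrite (wo_ltNge wo) => /negP nbx /(wo_ltW).
by [].
Qed.

Lemma small_setU U (A B : set U) : small A -> small B -> small (A `|` B).
Proof.
move=> sA sB; rewrite -bigcup2E; apply: small_bigcup => [|[|[|i]] _ //=].
- exact: small_countable.
- exact: small_countable (countable0 _).
Qed.

Lemma small_setX U V (A : set U) (B : set V) : small A -> small B -> small (A `*` B).
Proof.
move=> sA sB; have -> : A `*` B = \bigcup_(a in A) (pair a @` B).
  apply/seteqP; split=> [[a b] [/= Aa Bb]|_ [a Aa [b Bb <-]]//].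
  by exists a => //; exists b.
by apply: small_bigcup => // a _; exact: small_image.
Qed.

Lemma small_seq (U : eqType) (A : set U) :
  small A -> small [set s : seq U | forall a, a \in s -> A a].
Proof.
move=> sA; pose S n := [set s : seq U | size s = n /\ forall a, a \in s -> A a].
apply: (@small_sub _ _ (\bigcup_n S n)); first by move=> s sP; exists (size s).
apply: small_bigcup => [|n _]; first exact: small_countable.
elim: n => [|n IH].
  apply: (@small_sub _ _ [set [::]]); first by move=> s [/size0nil].
  exact: small_countable (countable1 _).
apply: (@small_sub _ _ ((fun p => p.1 :: p.2) @` (A `*` S n))); last first.
  exact/small_image/small_setX.
move=> [|a s] [//= [sn] sP]; exists (a, s) => //; split=> /=.
  by apply: sP; rewrite mem_head.
by split=> // b bs; apply: sP; rewrite inE bs orbT.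
Qed.

Lemma small_initial x : small [set y | r y x].
Proof.
apply: (@small_sub _ _ ([set y | wo_lt r y x] `|` [set x])).
  by move=> y /= yx; have [->|ynx] := eqVneq y x; [right|left; rewrite /wo_lt yx].
exact: small_setU (init x) (small_countable (countable1 x)).
Qed.

(** Closing off: [s n.+1] bounds the values of [b] at all tuples bounded by [s n], and [d] is the
    least upper bound of the [s n]. *)
Lemma small_closure_point (b : seq K -> nat -> K) :
  exists d, forall t n, (forall a, a \in t -> wo_lt r a d) -> wo_lt r (b t n) d.
Proof.
have step x : exists y, wo_lt r x y /\
    forall t n, (forall a, a \in t -> r a x) -> wo_lt r (b t n) y.
  have [|y yP] := @small_bounded ([set x] `|` (fun p => b p.1 p.2) @`
      ([set t : seq K | forall a, a \in t -> r a x] `*` [set: nat])).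
    apply: small_setU; first exact: small_countable (countable1 _).
    apply/small_image/small_setX; last exact: small_countable.
    exact: (@small_seq _ [set y | r y x] (small_initial x)).
  exists y; split; first by apply: yP; left.
  by move=> t n tx; apply: yP; right; exists (t, n).
have [g gP] := choice step.
have [x0 _] := @small_bounded set0 (small_countable (countable0 _)).
pose s n := iter n g x0.
have [|u uP] := @small_bounded (range s).
  exact/small_image/small_countable.
(* By minimality each point below [d] is at most some [s n]; hence so is every finite tuple below
   [d]. *)
have [d dP dmin] := @wo_min _ _ wo [set u | forall n, wo_lt r (s n) u]
  (ex_intro _ u (fun n => uP _ (ex_intro2 _ _ n I erefl))).
exists d => t n td.
have sm i j : (i <= j)%N -> r (s i) (s j).
  move=> /subnK <-; elim: (j - i)%N => [|k IH]; first exact: wo_refl.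
  by apply: (wo_trans wo) IH _; exact/wo_ltW/(gP _).1.
have [k kP] : exists k, forall a, a \in t -> r a (s k).
  elim: t td => [|a t IH] td; first by exists 0%N.
  have [|k kP] := IH; first by move=> c ct; apply: td; rewrite inE ct orbT.
  have [j aj] : exists j, r a (s j).
    apply: contrapT => nj; have /dmin : forall n, wo_lt r (s n) a.
      by move=> i; rewrite (wo_ltNge wo); apply/negP => ai; apply: nj; exists i.
    by have := td a (mem_head _ _); rewrite (wo_ltNge wo) => /negP.
  exists (maxn k j) => c; rewrite inE => /orP[/eqP->|/kP ck].
    by apply: (wo_trans wo) aj (sm _ _ (leq_maxr _ _)).
  by apply: (wo_trans wo) ck (sm _ _ (leq_maxl _ _)).
apply: wo_lt_trans (dP k.+1) => //; exact: (gP _).2.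
Qed.

(* [K] is the disjoint union of the infinite orbits of the successor map, so it is the product
   of the set of limit points with [nat], which absorbs a further factor [nat]. *)
Lemma surj_nat : exists p : K -> K * nat, forall q, exists a, p a = q.
Proof.
have sex x : exists y, wo_lt r x y /\ forall z, wo_lt r x z -> r y z.
  have [|y yP] := @small_bounded [set x]; first exact: small_countable (countable1 _).
  have [m mP mmin] := @wo_min _ _ wo [set y | wo_lt r x y] (ex_intro _ y (yP x erefl)).
  by exists m.
have [f fP] := choice sex.
have fI : injective f.
  have half x y : wo_lt r x y -> f x <> f y.
    move=> xy e; have := (fP x).2 y xy; rewrite e => fyy.
    by have := (fP y).1; rewrite (wo_ltNge wo) fyy.
  move=> x y fxy; have [//|nxy] := eqVneq x y.
  have /orP[xy|yx] := wo_total wo x y.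
    by have /half := introT andP (conj xy nxy).
  by rewrite eq_sym in nxy; have /half := introT andP (conj yx nxy); rewrite fxy.
pose lim l := forall x, f x <> l.
have orb a : exists q, lim q.1 /\ iter q.2 f q.1 = a.
  elim/(well_founded_ind (wo_lt_wf wo)): a => a IH.
  have [[x xa]|na] := pselect (exists x, f x = a).
    have [|q [ql qx]] := IH x; first by rewrite -xa; exact: (fP x).1.
    by exists (q.1, q.2.+1) => /=; rewrite qx.
  by exists (a, 0%N); split=> // x xa; apply: na; exists x.
have [q qP] := choice orb.
have qU l n a : lim l -> iter n f l = a -> q a = (l, n).
  have [] := qP a; case: (q a) => l' n' /= ll' <-{a} ll.
  elim: n n' => [|n IH] [|n'] //=.
  - by move=> ->.
  - by move=> /esym/ll.
  - by move=> /ll'.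
  - by move=> /fI/IH[-> ->].
(* The position in the orbit is read as the code of a pair (i, j): [i] is the position of the first
   component of the image, [j] is the second component. *)
exists (fun a => if unpickle (q a).2 is Some (i, j) then (iter i f (q a).1, j)
                 else (a, 0%N)) => -[b j].
have [ql qb] := qP b; exists (iter (pickle ((q b).2, j)) f (q b).1).
by rewrite (qU (q b).1 (pickle ((q b).2, j))) //= pickleK /= qb.
Qed.

End small.

(** * Baire category in the Cantor space *)

(* Open sets are described by agreement on initial segments; the library's product topology
   on [cantor] is not used. *)
Notation cantor := (nat -> bool).

Definition agree n (z w : cantor) := forall i, (i < n)%N -> z i = w i.

Definition cantor_open (O : set cantor) := forall z, O z -> exists n, forall w, agree n z w -> O w.

Definition cantor_dense (O : set cantor) := forall z n, exists2 w, agree n z w & O w.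

Definition comeager (A : set cantor) :=
  exists2 O : nat -> set cantor,
    forall n, cantor_open (O n) /\ cantor_dense (O n) & \bigcap_n O n `<=` A.

(** The string padded with [false]; [agree (size s) (of_seq s)] plays the role of the basic open set
    of [s]. *)
Definition of_seq (s : seq bool) : cantor := nth false s.

Lemma agree_sym n z w : agree n z w -> agree n w z.
Proof. by move=> zw i /zw. Qed.

Lemma agree_trans n w z v : agree n z w -> agree n w v -> agree n z v.
Proof. by move=> zw wv i ni; rewrite zw // wv. Qed.

Lemma agree_le m n z w : (m <= n)%N -> agree n z w -> agree m z w.
Proof. by move=> mn zw i im; apply: zw; exact: leq_trans mn. Qed.

Lemma agree_of_seq n z : agree n z (of_seq (mkseq z n)).
Proof. by move=> i ni; rewrite /of_seq nth_mkseq. Qed.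

Lemma cantor_openI A B : cantor_open A -> cantor_open B -> cantor_open (A `&` B).
Proof.
move=> oA oB z [/oA[n nA] /oB[m mB]]; exists (maxn n m) => w zw; split.
  by apply: nA; apply: agree_le zw; exact: leq_maxl.
by apply: mB; apply: agree_le zw; exact: leq_maxr.
Qed.

Lemma cantor_denseI A B :
  cantor_open A -> cantor_dense A -> cantor_dense B -> cantor_dense (A `&` B).
Proof.
move=> oA dA dB z n; have [w zw Aw] := dA z n; have [m mA] := oA w Aw.
have [v wv Bv] := dB w (maxn n m); exists v.
  by apply: agree_trans zw _; apply: agree_le wv; exact: leq_maxl.
by split=> //; apply: mA; apply: agree_le wv; exact: leq_maxr.
Qed.

Lemma cantor_open_dense_bigcap (O : nat -> set cantor) n :
  (forall i, cantor_open (O i) /\ cantor_dense (O i)) ->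
  cantor_open [set z | forall i, (i <= n)%N -> O i z] /\
  cantor_dense [set z | forall i, (i <= n)%N -> O i z].
Proof.
move=> oO; elim: n => [|n [IHo IHd]].
  have -> : [set z | forall i, (i <= 0)%N -> O i z] = O 0%N.
    by apply/seteqP; split=> [z|z Oz [|i]] //=; exact.
  exact: oO.
have -> : [set z | forall i, (i <= n.+1)%N -> O i z] =
    O n.+1 `&` [set z | forall i, (i <= n)%N -> O i z].
  apply/seteqP; split=> [z zO|z [zn zO] i /=].
    by split=> [|i /leqW]; exact: zO.
  by rewrite leq_eqVlt ltnS => /predU1P[->//|/zO].
by have [on dn] := oO n.+1; split; [exact: cantor_openI|exact: cantor_denseI].
Qed.

Lemma comeagerW A B : A `<=` B -> comeager A -> comeager B.
Proof. by move=> AB [ O oO OA]; exists O => //; exact: subset_trans AB. Qed.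

Lemma comeager_open O : cantor_open O -> cantor_dense O -> comeager O.
Proof. by move=> oO dO; exists (fun=> O) => // z zO; exact: (zO 0%N). Qed.

Lemma comeagerT : comeager setT.
Proof. by apply: comeager_open => [z _|z n]; [exists 0%N|exists z]. Qed.

Lemma comeager_bigcap (T : countType) (A : T -> set cantor) :
  (forall i, comeager (A i)) -> comeager (\bigcap_i A i).
Proof.
move=> cA; have /choice[ O OP] : forall i, exists O : nat -> set cantor,
    (forall n, cantor_open (O n) /\ cantor_dense (O n)) /\ \bigcap_n O n `<=` A i.
  by move=> i; have [ O ] := cA i; exists O.
exists (fun k => if unpickle k is Some (i, n) then O i n else setT) => [k|z zO i _].
  case: unpickle => [[i n]|]; first exact: (OP i).1.
  by split=> [z _|z n]; [exists 0%N|exists z].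
by apply: (OP i).2 => n _; have := zO (pickle (i, n)) I; rewrite pickleK.
Qed.

Lemma comeagerI A B : comeager A -> comeager B -> comeager (A `&` B).
Proof.
move=> cA cB.
apply: (comeagerW _ (@comeager_bigcap bool (fun b => if b then A else B) _)); last by case.
by move=> z zAB; split; [exact: (zAB true)|exact: (zAB false)].
Qed.

Lemma comeager_forall (T : countType) (A : T -> set cantor) :
  (forall i, comeager (A i)) -> comeager [set z | forall i, A i z].
Proof. by move=> /comeager_bigcap; apply: comeagerW => z zA i; exact: zA. Qed.

(** The Baire category theorem. Each [s k] is a point together with the length up to which it is
    fixed; stage k forces membership in [O k]. *)
Lemma comeager_dense A : comeager A -> cantor_dense A.
Proof.
move=> [ O oO OA] z n.
have step k (p : cantor * nat) : exists q : cantor * nat, [/\ (p.2 < q.2)%N,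
    agree p.2 p.1 q.1 & forall w, agree q.2 q.1 w -> O k w].
  have [w pw Ow] := (oO k).2 p.1 p.2; have [m mO] := (oO k).1 w Ow.
  exists (w, (maxn m p.2).+1); split=> //=; first by rewrite ltnS leq_maxr.
  by move=> v wv; apply: mO; apply: agree_le wv; rewrite leqW // leq_maxl.
have {step} /choice[g gP] : forall kp : nat * (cantor * nat), exists q : cantor * nat,
  [/\ (kp.2.2 < q.2)%N, agree kp.2.2 kp.2.1 q.1 & forall w, agree q.2 q.1 w -> O kp.1 w].
  by move=> [k p]; exact: step.
pose s := fix s k := if k is k'.+1 then g (k', s k') else (z, n).
have sS k : s k.+1 = g (k, s k) by [].
have sge k : (n + k <= (s k).2)%N.
  elim: k => [|k IH]; first by rewrite addn0.
  by rewrite addnS; apply: (leq_ltn_trans IH); rewrite sS; case: (gP (k, s k)).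
have sag i j : (i <= j)%N -> agree (s i).2 (s i).1 (s j).1 /\ ((s i).2 <= (s j).2)%N.
  move=> /subnK <-; elim: (j - i)%N => [|k [IH1 IH2]]; first by split.
  rewrite addSn sS; have [/= lt ag _] := gP ((k + i)%N, s (k + i)%N); split.
    by apply: agree_trans IH1 _; apply: agree_le ag.
  exact: leq_trans IH2 (ltnW lt).
(* The length fixed at stage [i.+1] exceeds [i], so this digit no longer changes. *)
pose w i := (s i.+1).1 i.
have wag k : agree (s k).2 (s k).1 w.
  move=> i ik; rewrite /w; have [ki|/ltnW ik'] := leqP k i.+1; first exact: (sag _ _ ki).1.
  by rewrite -(sag _ _ ik').1 //; have := sge i.+1; lia.
exists w; first exact: (wag 0%N).
apply: OA => k _; have [_ _] := gP (k, s k); apply; rewrite -sS; exact: wag.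
Qed.

Lemma comeager_nonempty A : comeager A -> A !=set0.
Proof. by move=> /comeager_dense/(_ (fun=> false) 0%N)[w _ Aw]; exists w. Qed.

(** Interleaving identifies the square of the Cantor space with the space itself, so that category
    in finite powers needs no separate notion. *)
Definition join (z w : cantor) : cantor := fun i => if odd i then w i./2 else z i./2.
Definition evens (v : cantor) : cantor := fun i => v i.*2.
Definition odds (v : cantor) : cantor := fun i => v i.*2.+1.

Lemma evens_join z w : evens (join z w) = z.
Proof. by apply/funext => i; rewrite /evens /join odd_double doubleK. Qed.

Lemma odds_join z w : odds (join z w) = w.
Proof. by apply/funext => i; rewrite /odds /join /= odd_double /= uphalf_double. Qed.

Lemma join_evens_odds v : join (evens v) (odds v) = v.
Proof.
apply/funext => i; rewrite /join /evens /odds; case: ifP => oi.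
  by rewrite -[in RHS](odd_double_half i) oi.
by rewrite -[in RHS](odd_double_half i) oi.
Qed.

Lemma agree_join n z z' w w' : agree n z z' -> agree n w w' -> agree n.*2 (join z w) (join z' w').
Proof. by move=> zz ww i ni; rewrite /join; case: ifP => _; [apply: ww|apply: zz]; lia. Qed.

Lemma agree_evens n v v' : agree n.*2 v v' -> agree n (evens v) (evens v').
Proof. by move=> vv i ni; apply: vv; lia. Qed.

Lemma agree_odds n v v' : agree n.*2 v v' -> agree n (odds v) (odds v').
Proof. by move=> vv i ni; apply: vv; lia. Qed.

(* Kuratowski-Ulam: a section of a dense open set is dense as soon as it meets the countably
   many basic open sets. *)
Lemma comeager_section A : comeager A -> comeager [set z | comeager [set w | A (join z w)]].
Proof.
move=> [ O oO OA].
pose B (ns : nat * seq bool) : set cantor :=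
  [set z | exists2 w, agree (size ns.2) (of_seq ns.2) w & O ns.1 (join z w)].
suff : comeager [set z | forall ns, B ns z].
  apply: comeagerW => z zB; exists (fun n => [set w | O n (join z w)]) => [n|w wO].
    split=> [w /(oO n).1[m mO]|w m].
      exists m => w' ww'; apply: mO; apply: (@agree_le _ m.*2); first by rewrite -addnn leq_addl.
      exact: agree_join.
    have [w' aw Ow] := zB (n, mkseq w m); exists w' => //.
    rewrite /= size_mkseq in aw; apply: agree_trans aw; exact: agree_of_seq.
  by apply: OA => n _; exact: wO.
apply: comeager_forall => -[n s]; apply: comeager_open => [z [/= w sw /(oO n).1[m mO]]|z m].
  exists m => z' zz'; exists w => //; apply: mO.
  by apply: (@agree_le _ m.*2); [rewrite -addnn leq_addl|exact: agree_join].
have [v av Ov] := (oO n).2 (join z (of_seq s)) (maxn m (size s)).*2.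
exists (evens v).
  by have /agree_evens := av; rewrite evens_join; apply: agree_le; exact: leq_maxl.
exists (odds v); last by rewrite join_evens_odds.
by have /agree_odds := av; rewrite odds_join; apply: agree_le; exact: leq_maxr.
Qed.

Definition xorc (u z : cantor) : cantor := fun i => z i (+) u i.

Lemma xorcK u : involutive (xorc u).
Proof. by move=> z; apply/funext => i; rewrite /xorc addbK. Qed.

Lemma agree_xorc n u z w : agree n z w -> agree n (xorc u z) (xorc u w).
Proof. by move=> zw i ni; rewrite /xorc zw. Qed.

Lemma comeager_xorc u A : comeager A -> comeager [set z | A (xorc u z)].
Proof.
move=> [ O oO OA]; exists (fun n => [set z | O n (xorc u z)]) => [n|z zO].
  split=> [z /(oO n).1[m mO]|z m].
    by exists m => w zw; apply: mO; exact: agree_xorc.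
  have [w aw Ow] := (oO n).2 (xorc u z) m; exists (xorc u w); last by rewrite /= xorcK.
  by rewrite -[z](xorcK u); exact: agree_xorc.
by apply: OA => n _; exact: zO.
Qed.

Definition infinite_support (u : cantor) := forall n, exists2 m, (n <= m)%N & u m.

Lemma comeager_xorc_infinite u : comeager [set z | infinite_support (xorc u z)].
Proof.
apply: comeager_forall => n; apply: comeager_open => [z [m nm um]|z k].
  exists m.+1 => w zw; exists m => //; by rewrite /xorc -zw.
exists (fun i => if (i < k)%N then z i else ~~ u i); first by move=> i ->.
exists (maxn n k); first exact: leq_maxl.
by rewrite /xorc ltnNge leq_maxr /=; case: (u _).
Qed.

(** * A dominating family from a base of the meager ideal *)

(** The finitely many strings of length [n] are treated one after the other; each time the common
    block on [n, h) is prolonged until the current string is forced into [O] as well. *)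
Lemma block_forcing (O : set cantor) n : cantor_open O -> cantor_dense O ->
  exists h (w : cantor), (n <= h)%N /\
    forall z : cantor, (forall i, (n <= i < h)%N -> z i = w i) -> O z.
Proof.
move=> oO dO.
suff [h [w [nh hw]]] : exists h (w : cantor), (n <= h)%N /\
    forall s, s \in [seq tval t | t <- enum {: n.-tuple bool}] ->
    forall z : cantor, agree n (of_seq s) z ->
    (forall i, (n <= i < h)%N -> z i = w i) -> O z.
  exists h, w; split=> // z; apply: (hw (mkseq z n)); last exact/agree_sym/agree_of_seq.
  by apply/mapP; exists [tuple of mkseq z n] => //; rewrite mem_enum.
elim: [seq _ | _ <- _] => [|s L [h [w [nh hw]]]]; first by exists n, (fun=> false).
pose z0 i := if (i < n)%N then of_seq s i else w i.
have [v v0 Ov] := dO z0 h; have [m mO] := oO v Ov.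
exists (maxn h m), v; split; first by rewrite leq_max nh.
move=> s'; rewrite inE => /predU1P[-> z sz zv|/hw{}hw z sz zv].
  apply: mO; apply: (@agree_le _ (maxn h m)); first exact: leq_maxr.
  move=> i ih; have [ni|ni] := leqP n i; first by rewrite zv // ni.
  by rewrite -v0 ?(leq_trans ni) // /z0 ni sz.
apply: (hw z sz) => i /andP[ni ih]; rewrite zv ?ni ?leq_max ?ih //.
by rewrite -v0 // /z0 ltnNge ni.
Qed.

(** A dense open set that records [g]: the larger [g] is, the harder it is for a comeager set to be
    contained in it. *)
Definition long_runs (g : nat -> nat) : set cantor :=
  [set z | exists n, forall i, (n <= i <= g n)%N -> z i].

Lemma comeager_long_runs g : comeager (long_runs g).
Proof.
apply: comeager_open => [z [n nz]|z n].
  exists (g n).+1 => w zw; exists n => i ing; rewrite -zw ?nz //.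
  by case/andP: ing.
exists (fun i => if (i < n)%N then z i else true); first by move=> i ->.
by exists n => i /andP[ni _]; rewrite ltnNge ni.
Qed.

(* If [g] exceeded [h] at infinitely many places, a point equal to the forcing blocks there and
   to [false] elsewhere would lie in [A] and have no long run. *)
Lemma comeager_dominates A : comeager A -> exists h : nat -> nat,
  forall g, {homo g : m n / (m <= n)%N} -> (forall n, (n <= g n)%N) -> A `<=` long_runs g ->
  exists n0, forall n, (n0 <= n)%N -> (g n <= h n)%N.
Proof.
move=> [ O oO OA].
have /choice[hw hwP] : forall n, exists hw : nat * cantor, (n <= hw.1)%N /\
    forall z : cantor, (forall i, (n <= i < hw.1)%N -> z i = hw.2 i) ->
    forall i, (i <= n)%N -> O i z.
  move=> n; have [on dn] := cantor_open_dense_bigcap n oO.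
  by have [h [w ?]] := block_forcing n on dn; exists (h, w).
pose h n := (hw n).1; exists h => g g_mono g_ge Ag; apply: contrapT => ng.
have /choice[f fP] : forall m, exists n, (m < n)%N /\ (h n < g n)%N.
  move=> m; apply: contrapT => nn; apply: ng; exists m.+1 => n mn.
  by rewrite leqNgt; apply/negP => hg; apply: nn; exists n.
pose s k := iter k (fun n => f (h n)) (f 0%N).
have sh k : (s k <= h (s k))%N by exact: (hwP _).1.
have hs k : (h (s k) < s k.+1)%N by exact: (fP _).1.
have hg k : (h (s k) < g (s k))%N by case: k => [|k]; exact: (fP _).2.
have hsj i j : (i < j)%N -> (h (s i) < s j)%N.
  elim: j => [//|j IH]; rewrite ltnS leq_eqVlt => /predU1P[->//|/IH ij].
  by have := sh j; have := hs j; lia.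
have ks k : (k <= s k)%N.
  by elim: k => [//|k IH]; have := sh k; have := hs k; lia.
pose z : cantor := fun i => `[< exists k, (s k <= i < h (s k))%N /\ (hw (s k)).2 i >].
have zin k i : (s k <= i < h (s k))%N -> z i = (hw (s k)).2 i.
  move=> ik; apply/asboolP/idP => [[j [ij wj]]|]; last by exists k.
  have [jk|kj|<-//] := ltngtP j k; first by have := hsj _ _ jk; lia.
  by have := hsj _ _ kj; lia.
have zout k : z (h (s k)) = false.
  apply/asboolP => -[j [ij _]].
  have [jk|kj|jk] := ltngtP j k; last by rewrite jk in ij; lia.
    by have := hsj _ _ jk; have := sh k; lia.
  by have := hsj _ _ kj; have := sh j; lia.
have /Ag[n nz] : A z.
  by apply: OA => i _; apply: ((hwP (s i)).2 z _ i (ks i)); exact: zin.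
(* A run of [true] starts in some block k, at n >= s k; it reaches g n >= g (s k) > h (s k), and so
   passes over h (s k), where [z] is false. *)
have /asboolP[k [/andP[kn nk] _]] : z n by apply: nz; rewrite leqnn g_ge.
suff: z (h (s k)) by rewrite zout.
by apply: nz; rewrite ltnW //= (leq_trans (ltnW (hg k))) // g_mono.
Qed.

(** [u a m] marks the values [D a j], j >= m, of an increasing majorant of the function [d a]
    attached to [H a]. Some [d a] eventually dominates a monotone majorant of [h]; once [m] has
    removed the exceptional indices, the marks below h n have index less than n. *)
Lemma sparse_family (K : Type) (H : K -> set cantor) :
  (forall a, comeager (H a)) -> (forall A, comeager A -> exists a, H a `<=` A) ->
  exists u : K -> nat -> cantor,
    [/\ forall a m, infinite_support (u a m),
        forall a m i, u a m i -> (m <= i)%N &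
        forall h : nat -> nat, exists a m0, forall m, (m0 <= m)%N ->
          forall n, (count (u a m) (iota 0 (h n)) <= n)%N].
Proof.
move=> cH Hbase.
have /choice[d dP] := fun a => comeager_dominates (cH a).
pose D a n := (\sum_(i < n.+1) (d a i).+1)%N.
have DS a n : D a n.+1 = (D a n + (d a n.+1).+1)%N by rewrite /D big_ord_recr.
have Dge a n : (n < D a n)%N /\ (d a n < D a n)%N.
  elim: n => [|n [IH _]]; first by rewrite /D big_ord1.
  by rewrite DS; lia.
have Dmono a m n : (m < n)%N -> (D a m < D a n)%N.
  elim: n => [//|n IH]; rewrite ltnS leq_eqVlt DS => /predU1P[->|/IH]; lia.
exists (fun a m i => `[< exists2 j, (m <= j)%N & i = D a j >]); split=> [a m n|a m i|h].
- exists (D a (maxn m n)); first by have [] := Dge a (maxn m n); lia.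
  by apply/asboolP; exists (maxn m n) => //; exact: leq_maxl.
- by move=> /asboolP[j mj ->]; have [] := Dge a j; lia.
pose g n := (\sum_(i < n.+1) (h i).+1)%N.
have gS n : g n.+1 = (g n + (h n.+1).+1)%N by rewrite /g big_ord_recr.
have gge n : (n < g n)%N /\ (h n < g n)%N.
  elim: n => [|n [IH _]]; first by rewrite /g big_ord1.
  by rewrite gS; lia.
have gmono : {homo g : m n / (m <= n)%N}.
  by apply: homo_leq => [//|? ? ?|n]; [exact: leq_trans|rewrite gS leq_addr].
have [a aP] := Hbase _ (comeager_long_runs g).
have [|m0 m0P] := dP a g gmono _ aP; first by move=> n; have [] := gge n; lia.
exists a, m0 => m m0m n.
have en : n = size (map (D a) (iota 0 n)) by rewrite size_map size_iota.
rewrite -size_filter [leqRHS]en; apply: uniq_leq_size; first exact/filter_uniq/iota_uniq.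
move=> i; rewrite mem_filter mem_iota add0n => /andP[/asboolP[j mj ->] /andP[_ jh]].
apply/mapP; exists j => //; rewrite mem_iota /= add0n ltnNge; apply/negP => nj.
have := m0P j (leq_trans m0m mj); have := gmono _ _ nj.
by have [_] := gge n; have [_] := Dge a j; lia.
Qed.

(** * Generic sequences and selections from omega-covers *)

Section generic.
Context {K : eqType} {r : rel K}.
Hypothesis wo : wochoice.well_order r.
Hypothesis init : forall x, ~~ ([set: K] #<= [set y | wo_lt r y x]).
Hypothesis reg : forall C, cofinal_set r C -> [set: K] #<= C.
Hypothesis unc : ~~ ([set: K] #<= [set: nat]).
Local Notation small := (@small K _).
Hypothesis cov : forall F : set (set cantor),
  small F -> F `<=` comeager -> exists z, forall A, F A -> A z.

(** Fewer than K comeager sets are intersected instead of countably many: regularity gives closure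
    under small intersections, and [cov] gives nonemptiness. *)
Definition kcomeager (E : set cantor) := exists F : set (set cantor),
  [/\ small F, F `<=` comeager & forall z, (forall A, F A -> A z) -> E z].

Lemma comeager_kcomeager A : comeager A -> kcomeager A.
Proof.
move=> cA; exists [set A]; split=> [|_ ->//|z]; last exact.
exact: (small_countable unc (countable1 A)).
Qed.

Lemma kcomeager_forall T (D : set T) (E : T -> set cantor) : small D ->
  (forall i, D i -> kcomeager (E i)) -> kcomeager [set z | forall i, D i -> E i z].
Proof.
move=> sD kE; have /choice[F FP] : forall i, exists F : set (set cantor), D i ->
    [/\ small F, F `<=` comeager & forall z, (forall A, F A -> A z) -> E i z].
  move=> i; have [Di|nDi] := pselect (D i); last by exists set0.
  by have [F ?] := kE _ Di; exists F.
exists (\bigcup_(i in D) F i); split.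
- by apply: (small_bigcup wo reg unc) => // i /FP[].
- by move=> A [i Di FA]; have [_ + _] := FP i Di; apply.
- by move=> z zF i Di; have [_ _] := FP i Di; apply=> A FA; apply: zF; exists i.
Qed.

Lemma kcomeagerI A B : kcomeager A -> kcomeager B -> kcomeager (A `&` B).
Proof.
move=> kA kB; have [|[] _//|F [sF cF FP]] :=
  @kcomeager_forall _ setT (fun b => if b then A else B).
  exact: (small_countable unc (countableP _)).
by exists F; split=> // z /FP zAB; split; [exact: (zAB true)|exact: (zAB false)].
Qed.

Lemma kcomeagerW A B : A `<=` B -> kcomeager A -> kcomeager B.
Proof. by move=> AB [F [sF cF FA]]; exists F; split=> // z /FA/AB. Qed.

Lemma kcomeager_xorc u A : kcomeager A -> kcomeager [set z | A (xorc u z)].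
Proof.
move=> [F [sF cF FA]]; exists ((fun A => [set z | A (xorc u z)]) @` F); split.
- exact: small_image.
- by move=> _ [B FB <-]; exact: comeager_xorc (cF B FB).
- by move=> z zF; apply: FA => B FB; apply: (zF [set z | B (xorc u z)]); exists B.
Qed.

(** All translates of [A] by finite strings have a common point [z]; the string that turns the
    beginning of [z] into [s] then yields the required point. *)
Lemma kcomeager_dense A s : kcomeager A -> exists2 z, agree (size s) (of_seq s) z & A z.
Proof.
move=> kA; have [|s' _|F [sF cF FP]] := @kcomeager_forall _ setT
    (fun s' : seq bool => [set z | A (xorc (of_seq s') z)]).
  exact: (small_countable unc (countableP _)).
  exact: kcomeager_xorc.
have [z zF] := cov sF cF.
pose s' := mkseq (fun i => z i (+) of_seq s i) (size s).
exists (xorc (of_seq s') z); last exact: (FP z zF s').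
by move=> i si; rewrite /xorc {2}/of_seq nth_mkseq // addKb.
Qed.

(* The tuple x_1, ..., x_n, w is coded by the single real [foldr join w [:: x_1; ...; x_n]]. *)
Definition section_at (A : set cantor) (xs : seq cantor) : set cantor :=
  [set w | A (foldr join w xs)].

Lemma section_at_rcons A xs x : section_at A (rcons xs x) = [set w | section_at A xs (join x w)].
Proof. by rewrite /section_at; apply/seteqP; split=> w /=; rewrite foldr_rcons. Qed.

Variable H : K -> set cantor.
Hypothesis cH : forall a, comeager (H a).

(** Genericity over [H b] is recorded by a comeager section, which, unlike mere membership, leaves
    room for further coordinates. *)
Definition generic_start (c : K -> cantor) :=
  forall d b, wo_lt r b d -> comeager (section_at (H b) [:: c d]).

(** An implication, so that it restricts [x] only, given [c] up to [a] and [z] below [a]; along an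
    increasing tuple these implications chain up from [generic_start]. *)
Definition generic_at (c z : K -> cantor) a (x : cantor) := forall d b (t : seq K),
  wo_lt r b d -> r d a -> (forall y, y \in t -> wo_lt r y a) ->
  comeager (section_at (H b) (c d :: map z t)) ->
  comeager (section_at (H b) (rcons (c d :: map z t) x)).

(** There are fewer than K triples (d, b, t) to consider, and [comeager_section] handles each of
    them. *)
Lemma kcomeager_generic_at c z a : kcomeager (generic_at c z a).
Proof.
have si := small_initial wo init reg unc a.
pose D : set (K * K * seq K) :=
  ([set d | r d a] `*` [set b | r b a]) `*` [set t : seq K | forall y, y \in t -> r y a].
pose E (p : K * K * seq K) := [set x |
  comeager (section_at (H p.1.2) (c p.1.1 :: map z p.2)) ->
  comeager (section_at (H p.1.2) (rcons (c p.1.1 :: map z p.2) x))].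
have [|p _|F [sF cF FP]] := @kcomeager_forall _ D E.
- apply: (small_setX wo reg unc); first exact: (small_setX wo reg unc).
  exact: (small_seq wo reg unc si).
- apply: comeager_kcomeager.
  have [cp|np] := pselect (comeager (section_at (H p.1.2) (c p.1.1 :: map z p.2))).
    by apply: comeagerW (comeager_section cp) => x; rewrite /E /= -rcons_cons section_at_rcons.
  by apply: comeagerW comeagerT => x _ /np.
exists F; split=> // x /FP xE d b t bd da ta; apply: (xE (d, b, t)).
by split=> [|y yt]; [split=> //=; exact/wo_ltW/(wo_lt_le_trans wo bd)|exact/wo_ltW/ta].
Qed.

(** The pairs (c_a, z_a) are chosen by recursion; demands on z'_a become demands on z_a through
    translation by [u a]. The prescribed strings [s a] will make both sequences dense. *)
Lemma generic_sequences (C : set cantor) (u : K -> cantor) (s : K -> seq bool) :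
  comeager C -> (forall a, infinite_support (u a)) -> (forall a i, u a i -> (size (s a) <= i)%N) ->
  exists c z, let z' a := xorc (u a) (z a) in
  [/\ generic_start c,
      forall a, C (z a) /\ C (z' a),
      forall a, generic_at c z a (z a) /\ generic_at c z' a (z' a),
      forall a, agree (size (s a)) (of_seq (s a)) (z a) /\
                agree (size (s a)) (of_seq (s a)) (z' a) &
      (forall a b, wo_lt r b a -> [/\ H b (z a), H b (z' a), infinite_support (xorc (z b) (z a)) &
                                 infinite_support (xorc (z' b) (z' a))]) /\
      forall a b, infinite_support (xorc (z' b) (z a))].
Proof.
move=> cC uinf us.
pose q (f : K -> cantor * cantor) b := xorc (u b) (f b).2.
(* [g] is the sequence that [x] continues, [h] the other one. *)
pose Cond (g h : K -> cantor) c a x := [/\ C x, generic_at c g a x &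
  forall b, wo_lt r b a ->
    [/\ H b x, infinite_support (xorc (g b) x) & infinite_support (xorc (h b) x)]].
have kCond g h c a : kcomeager (Cond g h c a).
  apply: (@kcomeagerW (C `&` (generic_at c g a `&` [set x | forall b, wo_lt r b a ->
    [/\ H b x, infinite_support (xorc (g b) x) & infinite_support (xorc (h b) x)]]))).
    by move=> x [Cx [gx bx]].
  apply: kcomeagerI; first exact: comeager_kcomeager.
  apply: kcomeagerI; first exact: kcomeager_generic_at.
  apply: (kcomeager_forall (init a)) => b _; apply: comeager_kcomeager.
  apply: (comeagerW _ (comeagerI (cH b) (comeagerI (comeager_xorc_infinite (g b))
    (comeager_xorc_infinite (h b))))).
  by move=> x [? []].
pose P a (f : K -> cantor * cantor) (v : cantor * cantor) :=
  (* [generic_at] includes the case d = a, so the condition on [v.2] involves [v.1], chosen at the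
     same stage. *)
  let c d := if d == a then v.1 else (f d).1 in
  [/\ forall b, wo_lt r b a -> comeager (section_at (H b) [:: v.1]),
      Cond (snd \o f) (q f) c a v.2, Cond (q f) (snd \o f) c a (xorc (u a) v.2) &
      agree (size (s a)) (of_seq (s a)) v.2].
have Pex a f : exists v, P a f v.
  have [|F [sF cF FP]] := @kcomeager_forall _ [set b | wo_lt r b a]
      (fun b => [set x | comeager (section_at (H b) [:: x])]) (init a) => [b _|].
    exact/comeager_kcomeager/comeager_section.
  have [x /FP xP] := cov sF cF.
  have [z sz [z1 z2]] := kcomeager_dense (s a) (kcomeagerI
    (kCond (snd \o f) (q f) (fun d => if d == a then x else (f d).1) a)
    (kcomeager_xorc (u a) (kCond (q f) (snd \o f) (fun d => if d == a then x else (f d).1) a))).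
  by exists (x, z).
have [f fP] := wo_recursion wo (point, point) Pex.
pose c a := (f a).1; pose z a := (f a).2; pose z' a := xorc (u a) (z a).
have lowE b a : wo_lt r b a -> below r (point, point) f a b = f b by rewrite /below => ->.
have gat (g h : K -> cantor) c0 a x : (forall b, wo_lt r b a -> g b = h b) ->
    (forall d, r d a -> c0 d = c d) -> generic_at c0 g a x -> generic_at c h a x.
  move=> gh cc gx d b t bd da ta; have := gx d b t bd da ta.
  by rewrite cc // (_ : map g t = map h t) //; apply/eq_in_map => y /ta/gh.
have cE a d : r d a -> (if d == a then (f a).1 else (below r (point, point) f a d).1) = c d.
  by move=> da; have [->//|ne] := eqVneq; rewrite lowE // /wo_lt da.
exists c, z; split=> [d b bd|a|a|a|].
- by have [+ _ _ _] := fP d; apply.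
- by have [_ [? _ _] [? _ _] _] := fP a.
- have [_ [_ g1 _] [_ g2 _] _] := fP a; split.
    by apply: (gat _ _ _ _ _ _ _ g1); [move=> b ba /=; rewrite lowE|exact: cE].
  by apply: (gat _ _ _ _ _ _ _ g2); [move=> b ba; rewrite /q lowE|exact: cE].
- have [_ _ _ az] := fP a; split=> // i si; rewrite /xorc az //.
  by case: (u a i) (us a i) => [/(_ isT)|_]; [rewrite leqNgt si|rewrite addbF].
have lt a b : wo_lt r b a ->
  [/\ [/\ H b (z a), infinite_support (xorc (z b) (z a)) &
          infinite_support (xorc (z' b) (z a))] &
      [/\ H b (z' a), infinite_support (xorc (z' b) (z' a)) &
          infinite_support (xorc (z b) (z' a))]].
  move=> ba; have [_ [_ _ /(_ b ba) h1] [_ _ /(_ b ba) h2] _] := fP a.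
  by move: h1 h2; rewrite /q /= lowE.
have xC x y : xorc x y = xorc y x by apply/funext => i; rewrite /xorc addbC.
split=> [a b /lt[[? ? ?] [? ? ?]]//|a b].
(* For a = b the difference is [u b]; otherwise the later stage has taken care of the earlier
   one. *)
have [->|ne] := eqVneq a b.
  suff -> : xorc (xorc (u b) (z b)) (z b) = u b by exact: uinf.
  by apply/funext => i; rewrite /xorc addKb.
have /orP[ab|ba] := wo_total wo a b.
  by rewrite xC; have [|_ []//] := lt b a; rewrite /wo_lt ab.
by have [|[]] := lt a b; rewrite // /wo_lt ba eq_sym.
Qed.

(* A real codes a sequence of naturals: the n-th one is the length of the run of [true] that
   starts at position n. *)
Definition run_at (c : cantor) n i := (forall j, (j < i)%N -> c (n + j)%N) /\ ~~ c (n + i)%N.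

Lemma run_at_inj c n i j : run_at c n i -> run_at c n j -> i = j.
Proof.
move=> [ci ni] [cj nj]; have [/cj|/ci|//] := ltngtP i j.
  by rewrite (negbTE ni).
by rewrite (negbTE nj).
Qed.

Fixpoint coords_in (Q : set cantor) l (v : cantor) : Prop :=
  if l is l'.+1 then Q (evens v) /\ coords_in Q l' (odds v) else True.

Lemma coords_in_foldr Q xs w :
  coords_in Q (size xs) (foldr join w xs) -> forall i, (i < size xs)%N -> Q (nth w xs i).
Proof.
elim: xs => [//|x xs IH] /=; rewrite evens_join odds_join => -[Qx /IH IHx] [|i]//.
exact: IHx.
Qed.

Lemma cantor_open_coords_in Q l : cantor_open Q -> cantor_open (coords_in Q l).
Proof.
move=> oQ; elim: l => [v _|l IH v [/oQ[n nQ] /IH[m mQ]]]; first by exists 0%N.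
exists (maxn n m).*2 => w vw; split.
  by apply: nQ; apply: agree_le (agree_evens vw); exact: leq_maxl.
by apply: mQ; apply: agree_le (agree_odds vw); exact: leq_maxr.
Qed.

(** Comeagerly many codes, made of a choice sequence and [l] reals, choose arbitrarily far out
    members that contain these reals and all z_a with [a] in a given [t]. Some [H (b (t, l))]
    consists of such codes. If [d] is closed under [b], then [c d] is a choice sequence that works
    for every finite set. *)
Lemma selection (c z : K -> cantor) (W : nat -> nat -> set cantor) :
  (forall A, comeager A -> exists a, H a `<=` A) ->
  generic_start c -> (forall a, generic_at c z a (z a)) ->
  (forall s : seq bool, exists a, agree (size s) (of_seq s) (z a)) ->
  (forall n i, cantor_open (W n i)) ->
  (forall n (t : seq K), exists i, forall a, a \in t -> W n i (z a)) ->
  exists i : nat -> nat, forall (t : seq K) m, exists2 n, (m <= n)%N &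
    forall a, a \in t -> W n (i n) (z a).
Proof.
move=> Hbase gc gz zdense oW Wcov.
pose P (t : seq K) l m : set cantor := [set v | exists n i, [/\ (m <= n)%N, run_at (evens v) n i,
  forall a, a \in t -> W n i (z a) & coords_in (W n i) l (odds v)]].
(* Codes whose first [l] reals are among the z_a are dense, and the covering hypothesis applies to
   them. *)
have zd l : forall v n, exists2 v', agree n v v' & exists t : seq K, forall Q : set cantor,
    (forall a, a \in t -> Q (z a)) -> coords_in Q l v'.
  elim: l => [|l IH] v n; first by exists v => //; exists [::].
  have [v' vv' [t tP]] := IH (odds v) n.
  have [a az] := zdense (mkseq (evens v) n); rewrite size_mkseq in az.
  exists (join (z a) v').
    rewrite -[v]join_evens_odds; apply: (@agree_le _ n.*2); first by rewrite -addnn leq_addl.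
    by apply: agree_join => //; apply: agree_trans az; exact: agree_of_seq.
  exists (a :: t) => Q Qt /=; rewrite evens_join odds_join; split.
    by apply: Qt; rewrite mem_head.
  by apply: tP => b bt; apply: Qt; rewrite inE bt orbT.
have cP t l : comeager [set v | forall m, P t l m v].
  apply: comeager_forall => m; apply: comeager_open.
    move=> v [n [i [mn [ci ni] tW /(cantor_open_coords_in (oW n i))[k kP]]]].
    exists (maxn (n + i).+1 k).*2 => w vw; exists n, i; split=> //.
      have vn := agree_evens vw; split=> [j ji|].
        by rewrite -vn ?ci // leq_max ltnS leq_add2l ltnW.
      by rewrite -vn // leq_max leqnn.
    by apply: kP; apply: agree_le (agree_odds vw); exact: leq_maxr.
  move=> v k; have [v' vv' [t' t'P]] := zd l (odds v) k.
  have [i iP] := Wcov (maxn m k) (t ++ t').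
  (* After the first maxn m k digits of [evens v] comes a run of exactly [i] ones: member [i] of
     cover number maxn m k is chosen. *)
  pose x j := if (j < maxn m k)%N then evens v j else (j < maxn m k + i)%N.
  exists (join x v').
    rewrite -[v]join_evens_odds; apply: (@agree_le _ k.*2); first by rewrite -addnn leq_addl.
    by apply: agree_join => // j jk; rewrite /x leq_max jk orbT.
  exists (maxn m k), i; rewrite evens_join odds_join; split; first exact: leq_maxl.
  - split=> [j ji|]; rewrite /x; first by rewrite ltnNge leq_addr /= ltn_add2l.
    by rewrite ltnNge leq_addr /= ltnn.
  - by move=> a ta; apply: iP; rewrite mem_cat ta.
  - by apply: t'P => a ta; apply: iP; rewrite mem_cat ta orbT.
have /choice[b bP] : forall p : seq K * nat, exists a, H a `<=` [set v | forall m, P p.1 p.2 m v].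
  by move=> p; exact: Hbase.
have [d dP] := small_closure_point wo init reg unc (fun t l => b (t, l)).
(* The default 0 is taken at positions where the run never ends. *)
exists (fun n => xget 0%N [set i | run_at (c d) n i]) => t m.
(* Indices below [d] become parameters of the comeager set; the others, in increasing order, follow
   [c d] as coordinates. *)
pose t0 := [seq a <- t | wo_lt r a d].
pose t1 := sort r (undup [seq a <- t | ~~ wo_lt r a d]).
have t1s : pairwise (wo_lt r) t1.
  rewrite -[pairwise _ _]/(pairwise [rel x y | r x y && (x != y)] t1).
  rewrite pairwise_relI -uniq_pairwise sort_uniq undup_uniq andbT -(sorted_pairwise (wo_trans wo)).
  exact/sort_sorted/wo_total.
have bd : wo_lt r (b (t0, size t1)) d by apply: dP => a; rewrite mem_filter => /andP[].
have t1d a : a \in t1 -> r d a.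
  by rewrite mem_sort mem_undup mem_filter (wo_ltNge wo) negbK => /andP[].
have [w Hw] : section_at (H (b (t0, size t1))) (c d :: map z t1) !=set0.
  apply: comeager_nonempty; move: (b _) bd => b0 bd.
  elim/last_ind: {t0 m} t1 t1s t1d => [|t1 a IH]; first by move=> _ _; exact: gc.
  rewrite pairwise_rcons => /andP[/allP ta t1s] t1d.
  rewrite map_rcons -rcons_cons; apply: (gz a) => //.
    by apply: t1d; rewrite mem_rcons mem_head.
  by apply: IH => // y yt; apply: t1d; rewrite mem_rcons inE yt orbT.
have [n [i [mn]]] := bP _ _ Hw m; rewrite /= evens_join odds_join => run t0W t1W.
exists n => // a ta; rewrite (_ : xget _ _ = i); last first.
  apply: (run_at_inj _ run).
  exact: (@xgetPex _ 0%N [set i | run_at (c d) n i] (ex_intro _ i run)).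
have [ad|nad] := boolP (wo_lt r a d); first by apply: t0W; rewrite mem_filter ad.
have at1 : a \in t1 by rewrite mem_sort mem_undup mem_filter nad.
rewrite -(size_map z) in t1W; have := coords_in_foldr t1W (i := index a t1).
by rewrite size_map index_mem => /(_ at1); rewrite (nth_map a) ?index_mem // nth_index.
Qed.

End generic.

(** * Binary expansions *)

Section expansion.
Context {R : realType}.
Local Open Scope ring_scope.

Lemma mkseqS (T : Type) (f : nat -> T) n : mkseq f n.+1 = f 0%N :: mkseq (fun i => f i.+1) n.
Proof. by rewrite /mkseq /= -[1%N]/(1 + 0)%N iotaDl -map_comp. Qed.

Definition frac (x : R) : R := x - (Num.floor x)%:~R.

(** Total and of period 1, so that sets of digit sequences pull back to the whole line. *)
Definition digits (x : R) : cantor := fun n => 2^-1 <= frac (x * 2 ^+ n).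

(** The affine map of [0, 1] onto the dyadic interval with binary prefix [s]. *)
Definition cell (s : seq bool) (y : R) : R := foldr (fun (b : bool) y => (b%:R + y) / 2) y s.

Definition cshift n (z : cantor) : cantor := fun i => z (n + i)%N.

Definition partial_sum (z : cantor) n : R := \sum_(i < n) (z i)%:R / 2 ^+ i.+1.

Definition of_digits (z : cantor) : R := limn (partial_sum z).

Lemma frac_itv x : 0 <= frac x < 1.
Proof. by have := floor_itv x; rewrite /frac intrD; lra. Qed.

Lemma frac_id x : 0 <= x < 1 -> frac x = x.
Proof.
move=> /andP[x0 x1]; rewrite /frac (_ : Num.floor x = 0) ?subr0 //.
by apply/eqP; rewrite floor_eq add0r x0.
Qed.

Lemma frac_addz (k : int) x : frac (k%:~R + x) = frac x.
Proof.
by rewrite /frac floorDzr ?intr_int // intrKfloor intrD; ring.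
Qed.

Lemma digits_addz (k : int) x : digits (k%:~R + x) = digits x.
Proof.
apply/funext => n; rewrite /digits mulrDl.
by rewrite (_ : k%:~R * 2 ^+ n = (k * 2 ^+ n)%:~R) ?frac_addz // intrM rmorphXn.
Qed.

Lemma digits_cons (b : bool) y : 0 <= y < 1 ->
  digits ((b%:R + y) / 2) = fun i => if i is i'.+1 then digits y i' else b.
Proof.
move=> /andP[y0 y1]; apply/funext => -[|i].
  rewrite /digits expr0 mulr1 frac_id; case: b => /=; lra.
rewrite -(digits_addz b y) -[_%:~R]/(b%:R : R) /digits exprS; congr (_ <= frac _).
by field.
Qed.

Lemma digits_cell (k : int) s y : 0 <= y < 1 ->
  agree (size s) (of_seq s) (digits (k%:~R + cell s y)).
Proof.
move=> y01; rewrite digits_addz; suff: 0 <= cell s y < 1 /\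
  agree (size s) (of_seq s) (digits (cell s y)) by case.
elim: s => [|b s [IH1 IH2]] //=; split; first by case: b => /=; lra.
by rewrite digits_cons // => -[|i] // /IH2.
Qed.

Lemma cell_digits x n : 0 <= x < 1 -> exists2 y, 0 <= y < 1 & x = cell (mkseq (digits x) n) y.
Proof.
elim: n x => [|n IH] x x01; first by exists x.
pose b := 2^-1 <= x; pose y := 2 * x - b%:R.
have y01 : 0 <= y < 1 by rewrite /y /b; case: (lerP 2^-1 x) => /=; lra.
have xE : x = (b%:R + y) / 2 by rewrite /y; field.
have [y' y'01 yE] := IH y y01; exists y' => //.
have -> : mkseq (digits x) n.+1 = b :: mkseq (digits y) n by rewrite xE mkseqS digits_cons.
by rewrite /= -yE.
Qed.

Lemma cellE s y : cell s y = cell s 0 + y / 2 ^+ size s.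
Proof.
elim: s => [|b s IH] /=; first by rewrite expr0 divr1 add0r.
by rewrite IH exprS; field; rewrite expf_neq0 // pnatr_eq0.
Qed.

Lemma cell_dist s y y' : 0 <= y <= 1 -> 0 <= y' <= 1 -> `|cell s y - cell s y'| <= 2^-1 ^+ size s.
Proof.
move=> y01 y'01; rewrite (cellE s y) (cellE s y') opprD addrACA subrr add0r -mulrBl.
rewrite normrM -exprVn [X in _ * X]ger0_norm; last by rewrite exprn_ge0 // invr_ge0.
by rewrite ler_piMl ?exprn_ge0 ?invr_ge0 // ler_norml; apply/andP; split; lra.
Qed.

Lemma cell_cat s t y : cell (s ++ t) y = cell s (cell t y).
Proof. by rewrite /cell foldr_cat. Qed.

Lemma small_pow (e : R) : 0 < e -> exists n, 2^-1 ^+ n < e.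
Proof.
move=> e0; have h1 : `|2^-1 : R| < 1 by rewrite ger0_norm ?invr_ge0 // invf_lt1 ?ltr1n.
have /cvgrPdist_lt/(_ e e0)[n _ nP] := cvg_expr h1.
exists n; have := nP n (leqnn n); rewrite sub0r normrN ger0_norm //.
Qed.

Lemma partial_sum_cell z n : partial_sum z n = cell (mkseq z n) 0.
Proof.
elim: n z => [|n IH] z; first by rewrite /partial_sum big_ord0.
rewrite mkseqS /= -IH.
rewrite /partial_sum big_ord_recl expr1 mulrDl; congr (_ + _).
by rewrite mulr_suml; apply: eq_bigr => i _; rewrite exprSr invfM mulrA.
Qed.

Lemma partial_sum_bounds z n : 0 <= partial_sum z n <= 1.
Proof.
rewrite partial_sum_cell; move: (mkseq z n) => s.
by elim: s => [|b s IH] /=; [rewrite lexx ler01|case: b => /=; lra].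
Qed.

Lemma partial_sum_cvg z : cvgn (partial_sum z).
Proof.
apply: nondecreasing_is_cvgn.
  apply/nondecreasing_seqP => n; rewrite /partial_sum big_ord_recr /= lerDl.
  by rewrite divr_ge0 // exprn_ge0.
by exists 1 => _ [n _ <-]; have /andP[] := partial_sum_bounds z n.
Qed.

Lemma of_digits_itv z : 0 <= of_digits z <= 1.
Proof.
apply/andP; split.
  by apply: limr_ge; [exact: partial_sum_cvg|near=> n; have /andP[] := partial_sum_bounds z n].
by apply: limr_le; [exact: partial_sum_cvg|near=> n; have /andP[] := partial_sum_bounds z n].
Unshelve. all: by end_near.
Qed.

Lemma of_digits_cons z : of_digits z = ((z 0)%:R + of_digits (cshift 1 z)) / 2.
Proof.
apply/cvg_lim => //; rewrite -(cvg_shiftS (partial_sum z)).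
rewrite (_ : [sequence _]_n = fun n => ((z 0)%:R + partial_sum (cshift 1 z) n) / 2).
  by apply: cvgMl; apply: cvgD; [exact: cvg_cst|exact: partial_sum_cvg].
apply/funext => n; by rewrite /= !partial_sum_cell mkseqS.
Qed.

Lemma of_digits_cell z n : of_digits z = cell (mkseq z n) (of_digits (cshift n z)).
Proof.
by elim: n z => [|n IH] z //; rewrite of_digits_cons IH mkseqS.
Qed.

Lemma of_digits_agree n z w : agree n z w -> `|of_digits z - of_digits w| <= 2^-1 ^+ n.
Proof.
move=> zw; rewrite (of_digits_cell z n) (of_digits_cell w n).
have -> : mkseq w n = mkseq z n by apply/eq_in_map => i; rewrite mem_iota => /zw.
have := @cell_dist (mkseq z n) _ _
  (of_digits_itv (cshift n z)) (of_digits_itv (cshift n w)).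
by rewrite size_mkseq.
Qed.

Lemma of_digits_gt0 (z : cantor) i : z i -> 0 < of_digits z.
Proof.
elim: i z => [|i IH] z zi; rewrite of_digits_cons.
  by rewrite zi /=; have := of_digits_itv (cshift 1 z); lra.
have := IH (cshift 1 z) zi; case: (z 0); rewrite /=; lra.
Qed.

Lemma of_digits_lt1 (z : cantor) i : ~~ z i -> of_digits z < 1.
Proof.
elim: i z => [|i IH] z zi; rewrite of_digits_cons.
  by rewrite (negbTE zi) /=; have := of_digits_itv (cshift 1 z); lra.
have := IH (cshift 1 z) zi; case: (z 0); rewrite /=; lra.
Qed.

(** Excludes the double expansions of dyadic rationals; here [digits] inverts [of_digits]. *)
Definition nondyadic : set cantor :=
  [set z | infinite_support z /\ infinite_support (fun i => ~~ z i)].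

Lemma comeager_nondyadic : comeager nondyadic.
Proof.
have := comeagerI (comeager_xorc_infinite (fun=> false)) (comeager_xorc_infinite (fun=> true)).
by apply: comeagerW => z [z1 z2]; split=> n; [have [m nm zm] := z1 n|have [m nm zm] := z2 n];
  exists m => //; move: zm; rewrite /xorc ?addbF ?addbT.
Qed.

Lemma of_digits_shift_itv z n : nondyadic z -> 0 < of_digits (cshift n z) < 1.
Proof.
move=> [/(_ n)[m nm zm] /(_ n)[k nk zk]]; apply/andP; split.
  by apply: (@of_digits_gt0 _ (m - n)); rewrite /cshift subnKC.
by apply: (@of_digits_lt1 _ (k - n)); rewrite /cshift subnKC.
Qed.

(** The bound is the distance from the point to the nearer end of its dyadic interval of length
    2^-n. *)
Lemma digits_near n z x : nondyadic z ->
  `|x - of_digits z| < Num.min (of_digits (cshift n z)) (1 - of_digits (cshift n z)) / 2 ^+ n ->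
  agree n z (digits x).
Proof.
move=> nz; have /andP[y0 y1] := of_digits_shift_itv n nz.
have p0 : 0 < 2 ^+ n :> R by exact: exprn_gt0.
rewrite ltr_pdivlMr // => xz.
have -> : x = 0%:~R + cell (mkseq z n) (of_digits (cshift n z) + (x - of_digits z) * 2 ^+ n).
  have ze : of_digits z = cell (mkseq z n) 0 + of_digits (cshift n z) / 2 ^+ n.
    by rewrite (of_digits_cell z n) cellE size_mkseq.
  by rewrite add0r cellE size_mkseq ze; field; rewrite gt_eqF.
have /digits_cell h : 0 <= of_digits (cshift n z) + (x - of_digits z) * 2 ^+ n < 1.
  move: xz; rewrite -[X in _ * X](gtr0_norm p0) -normrM lt_min !ltr_norml.
  by move=> /andP[/andP[? ?] /andP[? ?]]; apply/andP; split; lra.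
have := h 0 (mkseq z n); rewrite size_mkseq; exact/agree_trans/agree_of_seq.
Qed.

Lemma of_digitsK z : nondyadic z -> digits (of_digits z) = z.
Proof.
move=> nz; apply/funext => i; apply/esym/(@digits_near i.+1) => //.
rewrite subrr normr0 divr_gt0 ?exprn_gt0 // lt_min subr_gt0.
by have /andP[-> ->] := of_digits_shift_itv i.+1 nz.
Qed.

(** Every dyadic interval has a point off the closure of the nowhere dense set [N i], and a long
    enough expansion of that point gives a subinterval missing [N i]. *)
Lemma comeager_avoid (M : set R) : meager M -> comeager [set z | ~ M (of_digits z)].
Proof.
move=> [N Nnd MN]; pose U i := [set z | exists n, forall w, agree n z w -> ~ N i (of_digits w)].
apply: (@comeagerW [set z | forall i, U i z]).
  by move=> z zU /MN[i _ Nz]; have [n /(_ z)] := zU i; apply.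
apply: comeager_forall => i; apply: comeager_open => [z [n nP]|z n].
  by exists n => w zw; exists n => v wv; apply: nP; exact: agree_trans wv.
pose s := mkseq z n.
have [y y01 ny] : exists2 y, 0 < y < 1 & ~ closure (N i) (cell s y).
  apply: contrapT => nn; have : (closure (N i))^° (cell s 2^-1); last by rewrite Nnd.
  have p0 : 0 < 2 ^+ size s :> R by exact: exprn_gt0.
  apply/nbhs_ballP; exists (2^-1 / 2 ^+ size s) => /=; first by rewrite divr_gt0.
  move=> x; rewrite /ball /= ltr_pdivlMr // -[X in _ * X](gtr0_norm p0) -normrM ltr_norml => xs.
  pose y := 2^-1 - (cell s 2^-1 - x) * 2 ^+ size s.
  have -> : x = cell s y.
    by rewrite (cellE s y) /y (cellE s 2^-1); field; rewrite gt_eqF.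
  apply: contrapT => ny; apply: nn; exists y => //; rewrite /y; lra.
have /nbhs_ballP[eps /= e0 eN] : nbhs (cell s y) (~` closure (N i)).
  by apply: open_nbhs_nbhs; split=> //; exact/closed_openC/closed_closure.
have [m me] := small_pow e0.
have [|y' y'01 yE] := @cell_digits y m; first by lra.
pose t := s ++ mkseq (digits y) m.
have nm : (m <= size t)%N by rewrite size_cat !size_mkseq leq_addl.
exists (of_seq t).
  move=> j jn; rewrite /of_seq nth_cat size_mkseq jn nth_mkseq //.
exists (size t) => w tw Nw; apply: (eN (of_digits w)); last exact: subset_closure Nw.
rewrite /ball /= (of_digits_cell w (size t)).
have -> : mkseq w (size t) = t.
  apply: (@eq_from_nth _ false); rewrite ?size_mkseq // => j jt.
  by rewrite nth_mkseq // -tw.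
rewrite yE -cell_cat; apply: le_lt_trans (le_lt_trans _ me).
  apply: cell_dist; [lra|exact: of_digits_itv].
by apply: ler_wiXn2l => //; rewrite ?invr_ge0 // invf_le1 // ler1n.
Qed.

(** Every ball meets a dyadic interval whose points have digits in [O n], at its midpoint; a small
    ball around that midpoint avoids the exceptional set. *)
Lemma meager_digits (A : set cantor) : comeager A -> meager [set x | ~ A (digits x)].
Proof.
move=> [ O oO OA]; exists (fun n => [set x | ~ O n (digits x)]); last first.
  move=> x /= nA; apply: contrapT => nn; apply: nA; apply: OA => n _.
  by apply: contrapT => nO; apply: nn; exists n.
move=> n; rewrite /nowhere_dense -subset0 => x /nbhs_ballP[eps /= e0 eN].
have [m me] := small_pow e0.
have [y y01 xE] := cell_digits m (frac_itv x).
pose s := mkseq (digits (frac x)) m.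
have [w sw Ow] := (oO n).2 (of_seq s) m; have [k kO] := (oO n).1 w Ow.
pose t := mkseq w (maxn m k).
have inO y' : 0 <= y' < 1 -> O n (digits ((Num.floor x)%:~R + cell t y')).
  move=> y'01; apply: kO; have := @digits_cell (Num.floor x) t _ y'01; rewrite size_mkseq => h.
  apply: (@agree_le _ (maxn m k)); first exact: leq_maxr.
  exact: agree_trans (@agree_of_seq (maxn m k) w) h.
have p0 : 0 < 2 ^+ size t :> R by exact: exprn_gt0.
have /eN : ball x eps ((Num.floor x)%:~R + cell t 2^-1).
  rewrite /ball /= (_ : x - _ = frac x - cell t 2^-1); last by rewrite /frac; ring.
  have [t' tE] : exists t', t = s ++ t'.
    exists (mkseq (cshift m w) (maxn m k - m)).
    rewrite /t -{1}(subnKC (leq_maxl m k)) /mkseq iotaD map_cat add0n.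
    congr (_ ++ _); last by rewrite -{1}[m]addn0 iotaDl -map_comp.
    apply/eq_in_map => j; rewrite mem_iota => jm; rewrite -sw //.
    by rewrite /of_seq nth_mkseq.
  rewrite tE cell_cat {1}xE -/s; apply: le_lt_trans me.
  have -> : m = size s by rewrite size_mkseq.
  apply: cell_dist; first by lra.
  elim: t' {tE} => [|b t' IH] /=; first by lra.
  by case: b => /=; lra.
move=> /(_ (ball ((Num.floor x)%:~R + cell t 2^-1) (2^-1 / 2 ^+ size t))).
case=> [|v [/= nO]]; first by apply: nbhsx_ballx; rewrite divr_gt0.
rewrite /ball /= ltr_pdivlMr // -[X in _ * X](gtr0_norm p0) -normrM ltr_norml => xs.
apply: nO; pose y' := 2^-1 - ((Num.floor x)%:~R + cell t 2^-1 - v) * 2 ^+ size t.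
have -> : v = (Num.floor x)%:~R + cell t y'.
  by rewrite (cellE t y') /y' (cellE t 2^-1); field; rewrite gt_eqF.
by apply: inO; rewrite /y'; lra.
Qed.

End expansion.

(** * Two Luzin sequences *)

(** Moves a family of conditions from [T] to [I]: injectivity leaves at most one condition for each
    [i]. *)
Lemma comeager_fiber (T I : Type) (g : T -> I) (A : T -> set cantor) (i : I) :
  injective g -> (forall t, comeager (A t)) -> comeager [set z | forall t, g t = i -> A t z].
Proof.
move=> gI cA; have [[t <-]|nt] := pselect (exists t, g t = i).
  by apply: comeagerW (cA t) => z Az t' /gI ->.
by apply: comeagerW comeagerT => z _ t gt; case: nt; exists t.
Qed.

(** S_1(Omega, Omega) for countable open covers [W n] of the finite sets of points [z a]; the bound
    [m] asks that each finite set be caught infinitely often. *)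
Definition selective (K : eqType) (z : K -> cantor) := forall W : nat -> nat -> set cantor,
  (forall n i, cantor_open (W n i)) ->
  (forall n (t : seq K), exists i, forall a, a \in t -> W n i (z a)) ->
  exists i : nat -> nat, forall (t : seq K) m, exists2 n, (m <= n)%N &
    forall a, a \in t -> W n (i n) (z a).

(** A meager set is missed by all reals with digits in some [H b], hence by z_a whenever b is below
    a; only the fewer than K points with a <= b can lie in it. *)
Lemma luzin_range (R : realType) (r : rel (covM R)) (z : covM R -> cantor)
    (H : covM R -> set cantor) :
  wochoice.well_order r ->
  (forall x, ~~ ([set: covM R] #<= [set y | wo_lt r y x])) ->
  (forall C, cofinal_set r C -> [set: covM R] #<= C) ->
  ~~ ([set: covM R] #<= [set: nat]) ->
  (forall A, comeager A -> exists a, H a `<=` A) ->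
  (forall a, nondyadic (z a)) ->
  (forall a b, wo_lt r b a -> H b (z a) /\ infinite_support (xorc (z b) (z a))) ->
  luzin (covM R) (range (fun a => of_digits (z a) : R)).
Proof.
move=> wo init reg unc Hbase nz zP.
have zne a b : wo_lt r b a -> z a <> z b.
  move=> /zP[_ /(_ 0%N)[m _]] + zab; by rewrite /xorc zab addbb.
have zI : injective z.
  move=> a b zab; apply/eqP; apply: contraT => ne.
  have /orP[ab|ba] := wo_total wo a b.
    by have /zne := introT andP (conj ab ne); rewrite zab.
  by rewrite eq_sym in ne; have /zne := introT andP (conj ba ne); rewrite zab.
split.
  rewrite -(card_le_eql (card_setT _)); apply/card_leTP; exists (fun a => of_digits (z a)).
    by move=> a; exists a.
  by move=> a b /(congr1 digits); rewrite !of_digitsK // => /zI.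
move=> M mM; apply/andP; split.
  rewrite -(card_le_eqr (card_setT _)).
  apply: card_le_trans (card_image_le (fun a => of_digits (z a) : R) setT).
  by apply: subset_card_le => x [].
have [b bP] := Hbase _ (comeager_avoid mM).
rewrite -(card_le_eql (card_setT _)).
apply: (@small_sub _ _ _ ((fun a => of_digits (z a) : R) @` [set a | r a b])).
  move=> _ [[a _ <-] Ma]; exists a => //=; apply: contrapT => /negP.
  by rewrite -(wo_ltNge wo) => /zP[/bP].
apply: small_image; exact: small_initial.
Qed.

Lemma main_sequences (R : realType) : covM R #= cofM R -> regular_card (covM R) ->
  exists z z' : covM R -> cantor,
    [/\ (forall a, nondyadic (z a)) /\ (forall a, nondyadic (z' a)),
        luzin (covM R) (range (fun a => of_digits (z a) : R)) /\
        luzin (covM R) (range (fun a => of_digits (z' a) : R)),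
        selective z /\ selective z',
        forall a b, infinite_support (xorc (z' b) (z a)) &
        forall h : nat -> nat, exists a, forall n,
          (count (xorc (z' a) (z a)) (iota 0 (h n)) <= n)%N].
Proof.
move=> covcof [_ [r [wo init0] [_ reg]]].
have [[Fm Fcov] Fmin] := covMP R; have [[Gm Gbase] _] := cofMP R.
have init x : ~~ ([set: covM R] #<= [set y | wo_lt r y x]).
  have /andP[_] := init0 x; rewrite -(card_le_eql (card_setT (covM R))).
  by apply: small_sub => y /andP[yx /eqP ne].
(* By the Baire category theorem a countable family of meager sets does not cover the line. *)
have unc : ~~ ([set: covM R] #<= [set: nat]).
  apply/negP => /card_leTP[g _ gI].
  have cM (M : covM R) : comeager [set z | ~ (val M) (of_digits z : R)].
    exact/comeager_avoid/Fm/set_mem/valP.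
  have [z zP] := comeager_nonempty (comeager_forall (fun n => comeager_fiber n gI cM)).
  have [M FM Mz] : (\bigcup_(A in covM R) A) (of_digits z) by rewrite Fcov.
  exact: (zP _ (exist _ M (mem_set FM)) erefl).
(* Otherwise the complements, pulled back along [digits], would be a cover of the line by too few
   meager sets. *)
have cov (F : set (set cantor)) : @small (covM R) _ F -> F `<=` comeager ->
    exists z, forall A, F A -> A z.
  move=> sF cF; apply: contrapT => nz; move/negP: sF; apply.
  rewrite (card_le_eql (card_setT _)).
  pose G := (fun A => [set x : R | ~ A (digits x)]) @` F.
  apply: card_le_trans (card_image_le (fun A => [set x : R | ~ A (digits x)]) F).
  apply: Fmin; split=> [_ [A FA <-]|]; first exact/meager_digits/cF.
  rewrite -subTset => x _; apply: contrapT => nx; apply: nz; exists (digits x) => A FA.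
  by apply: contrapT => nA; apply: nx; exists [set x : R | ~ A (digits x)] => //; exists A.
(* Here cov(M) = cof(M) enters: a base of the meager ideal gets its indices from [covM R]. *)
have [g _ gI] : exists2 g : cofM R -> covM R, (forall M, setT (g M)) & injective g.
  apply/card_leTP; rewrite (card_le_eql (card_setT _)) (card_le_eqr (card_setT _)).
  by move: covcof; rewrite card_eq_le => /andP[].
pose H (k : covM R) : set cantor := nondyadic `&`
  [set z | forall M : cofM R, g M = k -> ~ (val M) (of_digits z : R)].
have cH k : comeager (H k).
  apply: comeagerI comeager_nondyadic (comeager_fiber k gI _) => M.
  exact/comeager_avoid/Gm/set_mem/valP.
have Hbase A : comeager A -> exists a, H a `<=` A.
  move=> /(@meager_digits R)/Gbase[M GM AM].
  exists (g (exist _ M (mem_set GM))) => z [nz /(_ _ erefl) Mz].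
  by apply: contrapT => nA; apply: Mz; apply: AM; rewrite /= of_digitsK.
have [u0 [u0inf u0ge u0h]] := sparse_family cH Hbase.
have [p pS] := surj_nat wo reg unc.
(* The second component of [p a] codes a number and a string, so every [u0 a m] and every string
   occur at some stage. Starting [u a] beyond the length of [s a] keeps z_a and z'_a equal on that
   string. *)
pose s a : seq bool := if @unpickle (nat * seq bool)%type (p a).2 is Some ms then ms.2 else [::].
pose u a := u0 (p a).1 (if @unpickle (nat * seq bool)%type (p a).2 is Some ms
                        then maxn ms.1 (size ms.2) else 0%N).
have us a i : u a i -> (size (s a) <= i)%N.
  rewrite /u /s; case: unpickle => [[m t]|] //= /u0ge; apply: leq_trans; exact: leq_maxr.
have [c [z [gc nz gz sz [zP zz]]]] := generic_sequences wo init reg unc cov cH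
  comeager_nondyadic (fun a => u0inf _ _ : infinite_support (u a)) us.
have sS (t : seq bool) : exists a, s a = t.
  have [a0 _] := u0h (fun=> 0%N).
  have [a pa] := pS (a0, pickle (0%N, t)); exists a.
  by rewrite /s pa /= pickleK.
exists z, (fun a => xorc (u a) (z a)); split.
- by split=> a; have [] := nz a.
- split.
    apply: (luzin_range wo init reg unc Hbase) => [a|a b /zP[]//]; exact: (nz a).1.
  apply: (luzin_range wo init reg unc Hbase) => [a|a b /zP[]//]; exact: (nz a).2.
- split=> W oW Wcov.
    apply: (selection wo init reg unc Hbase gc (fun a => (gz a).1)) => // t.
    by have [a <-] := sS t; exists a; exact: (sz a).1.
  apply: (selection wo init reg unc Hbase gc (fun a => (gz a).2)) => // t.
  by have [a <-] := sS t; exists a; exact: (sz a).2.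
- exact: zz.
move=> h; have [a0 [m0 m0P]] := u0h h.
have [a pa] := pS (a0, pickle (m0, Nil bool)); exists a => n.
rewrite (_ : xorc _ _ = u a); last by apply/funext => i; rewrite /xorc addKb.
by rewrite /u pa /= pickleK; apply: m0P; rewrite maxn0.
Qed.

(** * Spaces of continuous functions *)

Local Open Scope ring_scope.

Lemma denseP (Z : topologicalType) (D : set Z) : dense D <-> forall p, closure D p.
Proof.
split=> [dD p B|cD O [p Op] oO].
  rewrite nbhsE => -[U [oU Up] UB]; have [q [Uq Dq]] := dD U (ex_intro _ p Up) oU.
  by exists q; split=> //; exact: UB.
by have [q [Dq Oq]] := cD p O (open_nbhs_nbhs (conj oO Op)); exists q.
Qed.

(** The sequence [D] is split into infinitely many subsequences; the k-th one is used to accumulate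
    at the point [q k] of a countable dense set. *)
Lemma R_separable_of_strong_fan_tightness (Z : topologicalType) (T : countType)
    (q : T -> Z) (z0 : Z) :
  dense (range q) -> countable_strong_fan_tightness Z -> R_separable Z.
Proof.
move=> dq sft D dD.
have /choice[f fP] : forall k, exists f : nat -> Z,
    (forall j, D (pickle (k, j)) (f j)) /\ closure (range f) (q k).
  move=> k; have [|f fD fq] := sft (q k) (fun j => D (pickle (k, j))); last by exists f.
  by move=> j; exact: ((denseP _).1 (dD _)).
have /choice[g gP] : forall n, exists p, D n p.
  by move=> n; have [p [_ Dp]] := dD n setT (ex_intro _ z0 I) openT; exists p.
(* An [n] that decodes to a pair need not be its code; such [n] receive the arbitrary choice
   [g n]. *)
exists (fun n => if unpickle n is Some (k, j) then
   (if pickle (k, j) == n then f k j else g n) else g n) => [n|].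
  case: unpickle => [[k j]|]; last exact: gP.
  by case: ifPn => [/eqP <-|_]; [exact: (fP k).1|exact: gP].
move=> U Uq oU; have [y [Uy [k _ ky]]] := dq U Uq oU; rewrite -{}ky in Uy.
have [_ [[j _ <-] Ufj]] := (fP k).2 U (open_nbhs_nbhs (conj oU Uy)).
exists (f k j); split=> //; exists (pickle (k, j)) => //.
by rewrite pickleK eqxx.
Qed.

Lemma nbhs_initialP (S : choiceType) (T : topologicalType) (f : S -> T)
    (x : initial_topology f) (B : set (initial_topology f)) :
  nbhs x B <-> exists2 V : set T, nbhs (f x) V & f @^-1` V `<=` B.
Proof.
split=> [[_ /= [[W oW <-] /= Wx WB]]|[V nV VB]].
  by exists W => //; exact: open_nbhs_nbhs.
by apply: filterS VB _; exact: initial_continuous nV.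
Qed.

(** * Basic neighbourhoods and closures in C_p(X) *)

Section Cp.
Context {R : realType} {X : topologicalType}.

Definition ev (f : Cp R X) : X -> R := val f.

Lemma ev_continuous (f : Cp R X) : continuous (ev f).
Proof. exact: set_mem (valP f). Qed.

Lemma ev_sub_continuous (f h : Cp R X) : continuous (fun x => ev f x - ev h x).
Proof. by move=> x; apply: cvgB; exact: ev_continuous. Qed.

Definition to_Cp (f : X -> R) (cf : continuous f) : Cp R X :=
  exist (fun g : {ptws X -> R} => g \in [set h : {ptws X -> R} | continuous (h : X -> R)])
    f (mem_set cf).

Lemma ev_to_Cp f (cf : continuous f) : ev (to_Cp cf) = f.
Proof. by []. Qed.

(** The sets with the stated property form a filter; as the topology is a supremum over coordinates,
    its convergence to [h] is checked at one point [x] at a time. *)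
Lemma nbhs_ptwsP (h : {ptws X -> R}) (B : set {ptws X -> R}) : nbhs h B ->
  exists (xs : seq X) (e : R), 0 < e /\
    forall f : {ptws X -> R}, (forall x, x \in xs -> `|f x - h x| < e) -> B f.
Proof.
pose G : set_system {ptws X -> R} := [set B | exists (xs : seq X) (e : R), 0 < e /\
    forall f : {ptws X -> R}, (forall x, x \in xs -> `|f x - h x| < e) -> B f].
suff : G --> h by exact.
have FG : Filter G.
  split.
  - by exists [::], 1; split.
  - move=> P Q [xs [e [e0 xsP]]] [ys [d [d0 ysQ]]]; exists (xs ++ ys), (Num.min e d).
    split=> [|f fh]; first by rewrite lt_min e0.
    split; [apply: xsP|apply: ysQ] => x xin.
      by have := fh x; rewrite mem_cat xin lt_min => /(_ isT)/andP[].
    by have := fh x; rewrite mem_cat xin orbT lt_min => /(_ isT)/andP[].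
  - by move=> P Q PQ [xs [e [e0 xsP]]]; exists xs, e; split=> // f /xsP/PQ.
apply/cvg_sup => x A /(nbhs_initialP _ _)[V /nbhs_ballP[e /= e0 eV] VA].
exists [:: x], e; split=> // f fh; apply: VA; apply: eV.
by rewrite /ball /= distrC; apply: fh; rewrite mem_head.
Qed.

Lemma nbhs_CpP (h : Cp R X) (B : set (Cp R X)) : nbhs h B <->
  exists (xs : seq X) (e : R), 0 < e /\
    forall f, (forall x, x \in xs -> `|ev f x - ev h x| < e) -> B f.
Proof.
split=> [/(nbhs_initialP _ _)[V /nbhs_ptwsP[xs [e [e0 xsP]]] VB]|].
  by exists xs, e; split=> // f fh; apply: VB; exact: xsP.
move=> [xs [e [e0 xsP]]]; apply: filterS xsP _.
have nx x : nbhs h [set f | `|ev f x - ev h x| < e].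
  apply/(nbhs_initialP _ _); exists (@proj X (fun=> R) x @^-1` ball (ev h x) e).
    exact: (@proj_continuous X (fun=> R) x (val h) (ball (ev h x) e) (nbhsx_ballx _ _ e0)).
  by move=> f; rewrite /= /ball /= distrC.
elim: xs => [|x xs IH]; first by apply: filterS filterT => f _ x; rewrite in_nil.
by apply: filterS2 (nx x) IH => f fx fxs y; rewrite inE => /predU1P[->//|/fxs].
Qed.

Lemma closure_CpP (A : set (Cp R X)) (h : Cp R X) : closure A h <->
  forall (xs : seq X) (e : R), 0 < e ->
    exists2 f, A f & forall x, x \in xs -> `|ev f x - ev h x| < e.
Proof.
split=> [cA xs e e0|Ah B /nbhs_CpP[xs [e [e0 xsB]]]].
  have [|f [Af fh]] := cA [set f | forall x, x \in xs -> `|ev f x - ev h x| < e].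
    by apply/nbhs_CpP; exists xs, e.
  by exists f.
by have [f Af fh] := Ah xs e e0; exists f; split=> //; exact: xsB.
Qed.

End Cp.

Lemma closure_CpXP (R : realType) (X Y : topologicalType) (A : set (Cp R X * Cp R Y)) h g :
  closure A (h, g) <->
  forall (xs : seq X) (ys : seq Y) (e : R), 0 < e ->
    exists2 p, A p & (forall x, x \in xs -> `|ev p.1 x - ev h x| < e) /\
                     (forall y, y \in ys -> `|ev p.2 y - ev g y| < e).
Proof.
split=> [cA xs ys e e0|Ah B [[B1 B2] [/= nB1 nB2] B12]].
  have [|p [Ap ph]] := cA [set p | (forall x, x \in xs -> `|ev p.1 x - ev h x| < e) /\
                     (forall y, y \in ys -> `|ev p.2 y - ev g y| < e)].
    exists ([set f | forall x, x \in xs -> `|ev f x - ev h x| < e],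
            [set f | forall y, y \in ys -> `|ev f y - ev g y| < e]) => //=.
    by split; apply/nbhs_CpP; [exists xs, e|exists ys, e].
  by exists p.
move: nB1 nB2 => /nbhs_CpP[xs [e [e0 xsB]]] /nbhs_CpP[ys [d [d0 ysB]]].
have [|p Ap [p1 p2]] := Ah xs ys (Num.min e d); first by rewrite lt_min e0.
exists p; split=> //; apply: B12; split=> /=.
  by apply: xsB => x /p1; rewrite lt_min => /andP[].
by apply: ysB => x /p2; rewrite lt_min => /andP[].
Qed.

Lemma Cp_nearP (R : realType) (X : set R) (f : X -> R) : continuous f -> forall x e, 0 < e ->
  exists2 d, 0 < d & forall y : X, `|val y - val x| < d -> `|f y - f x| < e.
Proof.
move=> cf x e e0; have /(nbhs_initialP _ _)[V /nbhs_ballP[d /= d0 dV] VB] :=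
  cf x (ball (f x) e) (nbhsx_ballx _ _ e0).
exists d => // y yx; rewrite distrC; apply: VB; apply: dV.
by rewrite /ball /= distrC.
Qed.

(** * Strong fan tightness and R-separability *)

Section image.
Context {R : realType} {K : eqType} (z : K -> cantor).

Definition image_set : set R := range (fun a => of_digits (z a) : R).

Definition pt (a : K) : image_set :=
  exist (fun x => x \in image_set) (of_digits (z a)) (mem_set (ex_intro2 _ _ a I erefl)).

Lemma pt_surj (x : image_set) : exists a, x = pt a.
Proof. by have [a _ ax] := set_mem (valP x); exists a; apply: val_inj. Qed.

Lemma pt_seq (xs : seq image_set) : exists t : seq K, xs = map pt t.
Proof.
elim: xs => [|x xs [t ->]]; first by exists [::].
by have [a ->] := pt_surj x; exists (a :: t).
Qed.

Lemma pt_nearP (f : image_set -> R) : continuous f -> forall a e, 0 < e ->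
  exists n, forall b, agree n (z a) (z b) -> `|f (pt b) - f (pt a)| < e.
Proof.
move=> cf a e e0; have [d d0 dP] := Cp_nearP cf (pt a) e0.
have [n nd] := small_pow d0; exists n => b ab; apply: dP.
by rewrite distrC; exact: le_lt_trans (of_digits_agree ab) nd.
Qed.

(** A member of the n-th cover is a finite union of basic open sets on which some function in [U n]
    is within 1/(n+1) of [h]. By continuity these cover all finite sets, and a selection of members
    yields a selection of functions. *)
Lemma selective_strong_fan_tightness :
  selective z -> countable_strong_fan_tightness (Cp R image_set).
Proof.
move=> sz h U /(_ _)/closure_CpP cU.
pose err n : R := n.+1%:R^-1; have err0 n : 0 < err n by rewrite invr_gt0.
pose fits n (Is : seq (seq bool)) f := U n f /\ forall b s, s \in Is ->
  agree (size s) (of_seq s) (z b) -> `|ev f (pt b) - ev h (pt b)| < err n.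
(* Indexing by codes of lists of strings, not by functions, keeps the cover countable. *)
pose W n i : set cantor := if @unpickle (seq (seq bool)) i is Some Is then
  [set w | (exists f, fits n Is f) /\ exists2 s, s \in Is & agree (size s) (of_seq s) w]
  else set0.
have oW n i : cantor_open (W n i).
  rewrite /W; case: unpickle => [Is|] // w [fI [s sI sw]]; exists (size s) => v wv.
  by split=> //; exists s => //; exact: agree_trans wv.
have cW n (t : seq K) : exists i, forall a, a \in t -> W n i (z a).
  have [f Uf fh] := cU n (map pt t) _ (err0 n).
  suff [Is [fI It]] : exists Is, fits n Is f /\ forall a, a \in t ->
      exists2 s, s \in Is & agree (size s) (of_seq s) (z a).
    exists (pickle Is) => a /It sa; rewrite /W pickleK; split=> //; by exists f.
  elim: t fh => [|a t IH] fh; first by exists [::].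
  have [|Is [[_ fI] It]] := IH; first by move=> x xt; apply: fh; rewrite inE xt orbT.
  have fha : `|ev f (pt a) - ev h (pt a)| < err n by apply: fh; rewrite mem_head.
  have [|m mP] := pt_nearP (@ev_sub_continuous _ _ f h) a
    (e := err n - `|ev f (pt a) - ev h (pt a)|).
    by rewrite subr_gt0.
  exists (mkseq (z a) m :: Is); split; first split=> // b s.
    rewrite inE => /predU1P[->|]; last exact: fI.
    rewrite size_mkseq => ab; have := mP b (agree_trans (@agree_of_seq m (z a)) ab).
    set u := ev f (pt b) - _; set v := ev f (pt a) - _; have := ler_distD v u 0.
    by rewrite !subr0; lra.
  move=> b; rewrite inE => /predU1P[->|/It[s sI sb]]; last by exists s => //; rewrite inE sI orbT.
  by exists (mkseq (z a) m); rewrite ?mem_head // size_mkseq; exact/agree_sym/agree_of_seq.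
have [i iP] := sz W oW cW.
(* If no z_a lies in the chosen member, any element of [U n] will do. *)
have /choice[f fP] : forall n, exists f, U n f /\
    (forall a, W n (i n) (z a) -> `|ev f (pt a) - ev h (pt a)| < err n).
  move=> n; have [[a Wa]|nW] := pselect (exists a, W n (i n) (z a)); last first.
    have [f Uf _] := cU n [::] 1 ltr01.
    by exists f; split=> // a Wa; case: nW; exists a.
  move: Wa; rewrite /W; case: unpickle => [Is|] // [[f [Uf fI]] _].
  by exists f; split=> // b [_ [s sI sb]]; exact: fI sb.
exists f => [n|]; first exact: (fP n).1.
apply/closure_CpP => xs e e0; have [t ->] := pt_seq xs.
have [m me] : exists m, err m < e.
  have := near_infty_natSinv_lt (PosNum e0); case=> m _ mP; exists m; exact: (mP m (leqnn m)).
have [n mn nP] := iP t m; exists (f n); first by exists n.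
move=> _ /mapP[a /nP Wa ->]; apply: lt_trans me; apply: lt_le_trans ((fP n).2 a Wa) _.
by rewrite /err lef_pV2 ?posrE // ler_nat ltnS.
Qed.

End image.

(** * Rational polynomials as a countable dense set *)

Section separable.
Context {R : realType}.

(** Lists of rationals form a countable type; the empty list gives the zero function. *)
Definition rat_horner (s : seq rat) (x : R) : R := foldr (fun c y => ratr c + x * y) 0 s.

Lemma rat_horner_dense (p : {poly R}) (M e : R) : 0 < M -> 0 < e ->
  exists s, forall x, `|x| <= M -> `|rat_horner s x - p.[x]| < e.
Proof.
move=> M0; elim/poly_ind: p e => [|p c IH] e e0.
  by exists [::] => x _; rewrite /= horner0 subr0 normr0.
have [|s sP] := IH (e / 2 / M); first by rewrite !divr_gt0.
have [q] : exists q : rat, c - e / 2 < ratr q < c + e / 2.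
  have [|q] := @rat_in_itvoo R (c - e / 2) (c + e / 2); first by lra.
  by rewrite in_itv; exists q.
move=> /andP[q1 q2]; exists (q :: s) => x xM; rewrite /= hornerMXaddC.
rewrite (_ : _ - _ = (ratr q - c) + x * (rat_horner s x - p.[x])); last by ring.
apply: le_lt_trans (ler_normD _ _) _; rewrite normrM.
have h1 : `|ratr q - c| < e / 2 by rewrite ltr_norml; apply/andP; split; lra.
have h2 : `|x| * `|rat_horner s x - p.[x]| <= e / 2.
  rewrite -[leRHS](mulfVK (lt0r_neq0 M0)) mulrC; apply: ler_pM => //.
  exact/ltW/sP.
lra.
Qed.

Lemma interpolation (h : R -> R) (xs : seq R) :
  exists p : {poly R}, forall x, x \in xs -> p.[x] = h x.
Proof.
suff H : forall s : seq R, uniq s -> exists p : {poly R}, forall x, x \in s -> p.[x] = h x.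
  by have [p pP] := H (undup xs) (undup_uniq xs); exists p => x; rewrite -mem_undup => /pP.
elim=> [|a s IH] /=; first by exists 0.
move=> /andP[nas /IH[p pP]]; pose q : {poly R} := \prod_(x <- s) ('X - x%:P).
have qa : q.[a] != 0 by rewrite -[_ == 0]/(root q a) root_prod_XsubC.
exists (p + ((h a - p.[a]) / q.[a]) *: q) => x; rewrite inE hornerD hornerZ => /predU1P[->|xs'].
  by rewrite mulfVK // addrC subrK.
by rewrite (_ : q.[x] = 0) ?mulr0 ?addr0 ?pP //; apply/eqP; rewrite -/(root q x) root_prod_XsubC.
Qed.

Lemma comp_rat_horner_continuous (X : topologicalType) (v : X -> R) s :
  continuous v -> continuous (fun x => rat_horner s (v x)).
Proof.
move=> cv; elim: s => [|c s IH] x; first exact: cvg_cst.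
apply: cvgD; first exact: cvg_cst.
by apply: cvgM; [exact: cv|exact: IH].
Qed.

Lemma rat_horner_continuous (X : set R) s : continuous (fun x : X => rat_horner s (val x)).
Proof. by apply: comp_rat_horner_continuous; exact: initial_continuous. Qed.

(** Only finitely many values of [h] matter: they are interpolated by a real polynomial, whose
    coefficients are then approximated by rationals. *)
Lemma dense_rat_horner (X : set R) :
  dense (range (fun s => to_Cp (@rat_horner_continuous X s))).
Proof.
apply/denseP => h; apply/closure_CpP => xs e e0.
pose h' (x : R) := if pselect (X x) is left Xx then ev h (exist _ x (mem_set Xx)) else 0.
have h'E (x : X) : h' (val x) = ev h x.
  rewrite /h'; case: pselect => [Xx|[]]; last exact: set_mem (valP x).
  by congr ev; exact: val_inj.
have [p pP] := interpolation h' (map val xs).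
have M0 : 0 < 1 + \sum_(x <- xs) `|val x| by rewrite ltr_pwDl // sumr_ge0.
have [s sP] := rat_horner_dense p M0 e0.
exists (to_Cp (@rat_horner_continuous X s)); first by exists s.
move=> x xxs; rewrite ev_to_Cp -h'E -pP ?map_f //; apply: sP.
rewrite (big_rem x) //= addrCA lerDl addr_ge0 //; exact: sumr_ge0.
Qed.

Lemma selective_R_separable (K : eqType) (z : K -> cantor) : selective z ->
  R_separable (Cp R (@image_set R K z)).
Proof.
move=> sz; exact: (R_separable_of_strong_fan_tightness
  (to_Cp (@rat_horner_continuous (@image_set R K z) [::])) (@dense_rat_horner _)
  (selective_strong_fan_tightness sz)).
Qed.

End separable.

(** * The product *)

Section bump.
Context {R : realType}.

(** Zero at the centres [c.1], and at least 1 off the open intervals of radii [c.2] around them when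
    the radii are positive. *)
Definition bump (cs : seq (R * R)) (x : R) : R :=
  foldr (fun c y => `|x - c.1| / c.2 * y) 1 cs.

Lemma bump_centre cs c : c \in cs -> bump cs c.1 = 0.
Proof.
elim: cs => [//|d cs IH]; rewrite inE /= => /predU1P[->|/IH ->]; last by rewrite mulr0.
by rewrite subrr normr0 !mul0r.
Qed.

Lemma bump_far cs x : (forall c, c \in cs -> 0 < c.2) -> bump cs x < 1 ->
  exists2 c, c \in cs & `|x - c.1| < c.2.
Proof.
move=> cs0; apply: contraPP => nc; apply/negP; rewrite -leNgt.
have {nc}far c : c \in cs -> c.2 <= `|x - c.1|.
  by move=> ccs; rewrite leNgt; apply/negP => xc; apply: nc; exists c.
elim: cs cs0 far => [|c cs IH] cs0 far //=.
have [c0 xc] : 0 < c.2 /\ c.2 <= `|x - c.1| by split; [apply: cs0|apply: far]; rewrite mem_head.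
rewrite -[1]mulr1; apply: ler_pM => //; first by rewrite ler_pdivlMr // mul1r.
by apply: IH => d dcs; [apply: cs0|apply: far]; rewrite inE dcs orbT.
Qed.

Lemma comp_bump_continuous (X : topologicalType) (v : X -> R) cs :
  continuous v -> continuous (fun x => bump cs (v x)).
Proof.
move=> cv; elim: cs => [|c cs IH] x; first exact: cvg_cst.
apply: cvgM; last exact: IH.
apply: cvgMl; apply: cvg_norm; apply: cvgB; [exact: cv|exact: cvg_cst].
Qed.

(** This function equals [f] at the centres in [cs], and it is at least f + 1 + |f| >= 1 wherever
    the bump is at least 1. *)
Lemma lift_continuous (X : topologicalType) (v : X -> R) cs (f : Cp R X) : continuous v ->
  continuous (fun x => ev f x + (1 + `|ev f x|) * bump cs (v x)).
Proof.
move=> cv x; apply: cvgD; first exact: ev_continuous.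
apply: cvgM; last exact: comp_bump_continuous.
by apply: cvgD; [exact: cvg_cst|apply: cvg_norm; exact: ev_continuous].
Qed.

End bump.

(** The intervals around the points of [t] get the radii of [digits_near], so that values below 1
    occur only where the first [n] digits agree with those of such a point. *)
Lemma local_approx (R : realType) (K : eqType) (z : K -> cantor) n (t : seq K)
    (f : Cp R (@image_set R K z)) : (forall a, nondyadic (z a)) ->
  exists g : Cp R (@image_set R K z), (forall a, a \in t -> ev g (pt z a) = ev f (pt z a)) /\
    forall b, ev g (pt z b) < 1 -> exists2 a, a \in t & agree n (z a) (z b).
Proof.
move=> nz; pose rad a : R :=
  Num.min (of_digits (cshift n (z a))) (1 - of_digits (cshift n (z a))) / 2 ^+ n.
have rad0 a : 0 < rad a.
  rewrite divr_gt0 ?exprn_gt0 // lt_min subr_gt0.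
  by have /andP[-> ->] := @of_digits_shift_itv R (z a) n (nz a).
pose cs := [seq (of_digits (z a) : R, rad a) | a <- t].
have cval : continuous (fun x : @image_set R K z => val x : R) by exact: initial_continuous.
exists (to_Cp (@lift_continuous R _ _ cs f cval)); rewrite ev_to_Cp; split=> [a ta|b fb].
  rewrite (@bump_centre _ cs (of_digits (z a), rad a)) ?mulr0 ?addr0 //.
  by apply/mapP; exists a.
have [||c /mapP[a ta ->] /= ba] := @bump_far _ cs (of_digits (z b)).
- by move=> _ /mapP[a _ ->]; exact: rad0.
- rewrite ltNge; apply/negP => b1; move: fb; apply/negP; rewrite -leNgt /=.
  set u := ev f _; have : 1 + `|u| <= (1 + `|u|) * bump cs (of_digits (z b)).
    by rewrite ler_peMr // addr_ge0.
  have := ler_norm (- u); rewrite normrN; lra.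
by exists a => //; rewrite -(@of_digitsK R _ (nz b)); exact: digits_near.
Qed.

Section product.
Context {R : realType} {K : eqType} (z z' : K -> cantor).
Hypotheses (nz : forall a, nondyadic (z a)) (nz' : forall a, nondyadic (z' a)).
Hypothesis inf : forall a b, infinite_support (xorc (z' b) (z a)).
Hypothesis dom : forall h : nat -> nat, exists a, forall n,
  (count (xorc (z' a) (z a)) (iota 0 (h n)) <= n)%N.

Local Notation X := (@image_set R K z).
Local Notation Y := (@image_set R K z').

(* On the rectangle where both functions of [p] are less than 1, the n-th element (from 0) of
   the sum of the two reals is below k. *)
Definition witness n k : set (Cp R X * Cp R Y) := [set p | forall a b,
  ev p.1 (pt z a) < 1 -> ev p.2 (pt z' b) < 1 ->
  (n < count (xorc (z' b) (z a)) (iota 0 k))%N].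

Lemma count_iota_le (u : cantor) k l : (k <= l)%N ->
  (count u (iota 0 k) <= count u (iota 0 l))%N.
Proof. by move=> /subnKC <-; rewrite iotaD count_cat leq_addr. Qed.

Lemma infinite_support_count u n : infinite_support u -> exists k, (n < count u (iota 0 k))%N.
Proof.
move=> iu; elim: n => [|n [k nk]].
  have [m _ um] := iu 0%N; exists m.+1.
  by rewrite -[m.+1]addn1 iotaD count_cat /= um addn1.
have [m km um] := iu k; exists m.+1.
rewrite -[m.+1]addn1 iotaD count_cat /= um; have := count_iota_le u km; lia.
Qed.

Lemma witness_le n k l : (k <= l)%N -> witness n k `<=` witness n l.
Proof. by move=> kl p pk a b pa pb; apply: leq_trans (pk a b pa pb) (count_iota_le _ kl). Qed.

Lemma eq_count_agree u v k : agree k u v -> count u (iota 0 k) = count v (iota 0 k).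
Proof. by move=> uv; apply: eq_in_count => i; rewrite mem_iota => /uv. Qed.

(** One [k] works for the finitely many pairs of given points. By [local_approx] the functions can
    be made at least 1 except near these points, where the first [k] digits, and so the counts, are
    the same. *)
Lemma closure_witness n p : closure (\bigcup_k witness n k) p.
Proof.
case: p => f g; apply/closure_CpXP => xs ys e e0.
have [t ->] := pt_seq xs; have [t' ->] := pt_seq ys.
have [k kP] : exists k, forall ab, ab \in [seq (a, b) | a <- t, b <- t'] ->
    (n < count (xorc (z' ab.2) (z ab.1)) (iota 0 k))%N.
  elim: [seq _ | _ <- _, _ <- _] => [|ab s [k kP]]; first by exists 0%N.
  have [l lP] := infinite_support_count n (inf ab.1 ab.2); exists (maxn k l) => cd.
  rewrite inE => /predU1P[->|/kP cdk].
    by apply: leq_trans lP (count_iota_le _ _); exact: leq_maxr.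
  by apply: leq_trans cdk (count_iota_le _ _); exact: leq_maxl.
have [f' [f'f f'P]] := local_approx k t f nz.
have [g' [g'g g'P]] := local_approx k t' g nz'.
exists (f', g').
  exists k => // a b /= /f'P[a0 a0t a0a] /g'P[b0 b0t b0b].
  have := kP (a0, b0) (allpairs_f _ a0t b0t); congr (_ < _)%N.
  by apply: eq_count_agree => i ik; rewrite /xorc a0a // b0b.
by split=> _ /mapP[a at' ->] /=; rewrite (f'f, g'g) // subrr normr0.
Qed.

(** Finiteness puts each [F n] into [witness n (h n)] for a single [h]. For the index [a] that [dom]
    gives for [h], no pair in any [F n] is below 1 at both z_a and z'_a, so the zero pair has a
    neighbourhood missing all of them. *)
Lemma not_closure_finite_witness (F : nat -> set (Cp R X * Cp R Y)) :
  (forall n, finite_set (F n) /\ F n `<=` \bigcup_k witness n k) ->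
  ~ closure (\bigcup_n F n) (to_Cp (@rat_horner_continuous R X [::]),
                            to_Cp (@rat_horner_continuous R Y [::])).
Proof.
move=> FP.
have /choice[h hP] : forall n, exists k, F n `<=` witness n k.
  move=> n; have [/finite_seqP[s sE] Fw] := FP n; rewrite sE in Fw *.
  elim: s {sE} Fw => [|p s IH] Fw; first by exists 0%N.
  have [|k kP] := IH; first by move=> q qs; apply: Fw; rewrite /= inE qs orbT.
  have [l _ lP] : (\bigcup_k witness n k) p by apply: Fw; rewrite /= mem_head.
  exists (maxn k l) => q; rewrite /= inE => /predU1P[->|/kP].
    by apply: witness_le lP; exact: leq_maxr.
  by apply: witness_le; exact: leq_maxl.
have [a aP] := dom h.
move=> /closure_CpXP/(_ [:: pt z a] [:: pt z' a] 1 ltr01).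
move=> [p [n _ Fp]] [p1 p2].
have small1 (U : R) : `|U - 0| < 1 -> U < 1 by rewrite subr0; exact/le_lt_trans/ler_norm.
have := hP n p Fp a a (small1 _ (p1 _ (mem_head _ _))) (small1 _ (p2 _ (mem_head _ _))).
by rewrite ltnNge aP.
Qed.

Lemma product_not_countable_fan_tightness : ~ countable_fan_tightness (Cp R X * Cp R Y)%type.
Proof.
move=> cft; pose zero (U : set R) : Cp R U := to_Cp (@rat_horner_continuous R U [::]).
have [n|F FP cF] := cft (zero X, zero Y) (fun n => \bigcup_k witness n k).
  exact: closure_witness.
exact: (not_closure_finite_witness FP cF).
Qed.

Lemma product_not_M_separable : ~ M_separable (Cp R X * Cp R Y)%type.
Proof.
move=> ms; have [n|F FP /denseP dF] := ms (fun n => \bigcup_k witness n k).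
  by apply/denseP; exact: closure_witness.
exact: (not_closure_finite_witness FP (dF _)).
Qed.

End product.

Local Close Scope ring_scope.

Theorem corollary4p1 (R : realType) :
  covM R #= cofM R -> regular_card (covM R) ->
  exists X Y : set R,
    [/\ luzin (covM R) X /\ luzin (covM R) Y,
        countable_strong_fan_tightness (Cp R X) /\
        countable_strong_fan_tightness (Cp R Y),
        R_separable (Cp R X) /\ R_separable (Cp R Y),
        ~ countable_fan_tightness (Cp R X * Cp R Y)%type &
        ~ M_separable (Cp R X * Cp R Y)%type].
Proof.
move=> covcof reg.
have [z [z' [[nz nz'] [lz lz'] [sz sz'] inf dom]]] := main_sequences covcof reg.
exists (image_set z), (image_set z'); split.
- by split.
- by split; exact: selective_strong_fan_tightness.
- by split; exact: selective_R_separable.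
- exact: product_not_countable_fan_tightness.
- exact: product_not_M_separable.
Qed.
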